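(* Let $p\equiv 3 \pmod 8$ be prime. (1) There is no elliptic curve $E$ over $K=\mathbb{Q}(\sqrt{p})$ with everywhere good reduction over $K$ and $j(E)\in\mathbb{Q}$. (2) There is no elliptic curve $E$ over $K=\mathbb{Q}(\sqrt{-p})$ with everywhere good reduction over $K$ and $j(E)\in\mathbb{Q}$.
   Context: An elliptic curve $E/K$ has everywhere good reduction if it has good reduction at every prime of $\mathcal{O}_K$. *)

(* Defs.v *)
From HB Require Import structures.
From mathcomp Require Import all_boot all_order all_algebra all_field.
Set Implicit Arguments. Unset Strict Implicit. Unset Printing Implicit Defensive.
Import Order.TTheory GRing.Theory Num.Theory.
Local Open Scope ring_scope.

Definition inQuadField (d : int) (x : algC) : Prop :=
  exists a b : rat, x = ratr a + ratr b * sqrtC (d%:~R).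

Definition inOK (d : int) (x : algC) : Prop := inQuadField d x /\ x \in Aint.

Definition is_prime_ideal (d : int) (P : algC -> Prop) : Prop :=
  (forall x, P x -> inOK d x) /\
  P 0 /\
  (forall x y, P x -> P y -> P (x + y)) /\
  (forall a x, inOK d a -> P x -> P (a * x)) /\
  ~ P 1 /\
  (forall x y, inOK d x -> inOK d y -> P (x * y) -> P x \/ P y) /\
  (exists x, P x /\ x != 0).

Definition Pintegral (d : int) (P : algC -> Prop) (x : algC) : Prop :=
  exists a s, [/\ inOK d a, inOK d s, ~ P s & x = a / s].

Definition Punit (d : int) (P : algC -> Prop) (x : algC) : Prop :=
  x != 0 /\ Pintegral d P x /\ Pintegral d P x^-1.

(* Weierstrass equations y^2 + a1 xy + a3 y = x^3 + a2 x^2 + a4 x + a6 *)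
Record weier := Weier { a1 : algC; a2 : algC; a3 : algC; a4 : algC; a6 : algC }.

Definition wb2 (E : weier) := a1 E ^+ 2 + 4%:R * a2 E.
Definition wb4 (E : weier) := 2%:R * a4 E + a1 E * a3 E.
Definition wb6 (E : weier) := a3 E ^+ 2 + 4%:R * a6 E.
Definition wb8 (E : weier) :=
  a1 E ^+ 2 * a6 E + 4%:R * a2 E * a6 E - a1 E * a3 E * a4 E
  + a2 E * a3 E ^+ 2 - a4 E ^+ 2.
Definition wc4 (E : weier) := wb2 E ^+ 2 - 24%:R * wb4 E.
Definition disc (E : weier) :=
  - wb2 E ^+ 2 * wb8 E - 8%:R * wb4 E ^+ 3 - 27%:R * wb6 E ^+ 2
  + 9%:R * wb2 E * wb4 E * wb6 E.
Definition jinv (E : weier) := wc4 E ^+ 3 / disc E.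

Definition ell_curve_over (d : int) (E : weier) : Prop :=
  inQuadField d (a1 E) /\ inQuadField d (a2 E) /\ inQuadField d (a3 E) /\
  inQuadField d (a4 E) /\ inQuadField d (a6 E) /\ disc E != 0.

(* the model obtained by the change of variables
   x = u^2 x' + r,  y = u^3 y' + s u^2 x' + t   (Silverman III.1) *)
Definition change (E : weier) (u r s t : algC) : weier :=
  Weier ((a1 E + 2%:R * s) / u)
        ((a2 E - s * a1 E + 3%:R * r - s ^+ 2) / u ^+ 2)
        ((a3 E + r * a1 E + 2%:R * t) / u ^+ 3)
        ((a4 E - s * a3 E + 2%:R * r * a2 E - (t + r * s) * a1 E
           + 3%:R * r ^+ 2 - 2%:R * s * t) / u ^+ 4)
        ((a6 E + r * a4 E + r ^+ 2 * a2 E + r ^+ 3 - t * a3 E - t ^+ 2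
           - r * t * a1 E) / u ^+ 6).

Definition good_reduction_at (d : int) (E : weier) (P : algC -> Prop) : Prop :=
  exists u r s t,
    inQuadField d u /\ u != 0 /\ inQuadField d r /\ inQuadField d s /\
    inQuadField d t /\
    let E' := change E u r s t in
    Pintegral d P (a1 E') /\ Pintegral d P (a2 E') /\ Pintegral d P (a3 E') /\
    Pintegral d P (a4 E') /\ Pintegral d P (a6 E') /\ Punit d P (disc E').

Definition everywhere_good (d : int) (E : weier) : Prop :=
  forall P, is_prime_ideal d P -> good_reduction_at d E P.

Definition is_rational (x : algC) : Prop := exists q : rat, x = ratr q.

(* Main.v *)
(* Let D, c4, c6 and j = A^3 be the invariants of a model with coefficients in O_K.  Good
   reduction at every prime makes j the cube of an integer A, makes j - 1728 have even valuation
   at every unramified prime, and makes the norm of D, up to sign, a fourth power n^4; since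
   c6^2 = (j - 1728) D, the norm of c6 is +-(j - 1728) n^2.  Now look at a model that is good at 2.
   If the reduction is ordinary, A is odd and the norm of c6 is 1 mod 8 (mod 4 when 2 is inert).
   If it is supersingular, 16 divides A and the norm of c6 is 64 times such a number, except that
   for 2 ramified it may also happen that the norm of c4 is 16 times a number congruent to 5 mod 8,
   which is absurd because the norm of c4 is up to sign a square.  As p = 3 mod 8, comparing the two
   expressions of the norm of c6 shows that p has even valuation in j - 1728.  Hence
   A^3 - 1728 = +-y^2.  The factor A^2 + 12 A + 144 (divided by 16 when 16 divides A) is then a
   square or three times a square, and this, with the cofactor A - 12, is impossible mod 8. *)
Require Import Defs.
From HB Require Import structures.
From mathcomp Require Import all_boot all_order all_algebra all_field.
From mathcomp Require Import ring zify.
Import Order.TTheory GRing.Theory Num.Theory.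
Local Open Scope ring_scope.
Set Implicit Arguments. Unset Strict Implicit. Unset Printing Implicit Defensive.

(** * Squares, cubes and the equation A^3 - 1728 = +-y^2 *)

(** Strong induction on [m]: the smallest prime factor [l] has as exponent a positive multiple of
    [n], so [l ^ n] divides [m], and the quotient inherits the hypothesis. *)
Lemma perfect_power (n m : nat) : (0 < m)%N -> (0 < n)%N ->
  (forall l, prime l -> n %| logn l m)%N -> exists r, m = (r ^ n)%N.
Proof.
move=> m0 n0; elim/ltn_ind: m m0 => m IH m0 H.
have [->|m1] := eqVneq m 1%N; first by exists 1%N; rewrite exp1n.
have pl : prime (pdiv m) by apply: pdiv_prime; lia.
set l := pdiv m in pl *.
have dl : (l %| m)%N := pdiv_dvd m.
have ll : (0 < logn l m)%N by rewrite logn_gt0 mem_primes pl m0.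
have dm : (l ^ n %| m)%N.
  rewrite pfactor_dvdn //; apply: dvdn_leq => //; exact: H.
have [q eq] := dvdnP dm.
have q0 : (0 < q)%N by move: m0; rewrite eq muln_gt0 => /andP[].
have ln1 : (1 < l ^ n)%N by rewrite -{1}(exp1n n) ltn_exp2r // prime_gt1.
have [r hr] : exists r, q = (r ^ n)%N.
  apply: IH => //; first by rewrite eq ltn_Pmulr.
  move=> l' pl'; have := H l' pl'.
  rewrite {1}eq lognM ?(ltnW ln1) // lognX dvdn_addl //.
  exact: dvdn_mulr.
by exists (r * l)%N; rewrite eq hr expnMn.
Qed.

Lemma square_up_to_prime (q m : nat) : prime q -> (0 < m)%N ->
  (forall l, prime l -> l != q -> 2 %| logn l m)%N ->
  exists z, m = (z ^ 2)%N \/ (q * m = z ^ 2)%N.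
Proof.
move=> pq m0 H; have [e|o] := boolP (2 %| logn q m)%N.
  have [|r ->] := @perfect_power 2 m m0 isT; last by exists r; left.
  by move=> l pl; have [->|/H->] := eqVneq l q.
have [||r hr] := @perfect_power 2 (q * m) _ isT; last by exists r; right.
  by rewrite muln_gt0 prime_gt0.
move=> l pl; rewrite lognM ?(prime_gt0 pq) // logn_prime //.
have [->|nl] := eqVneq l q; first by move: o; rewrite !dvdn2 oddD => /negPn -> /=; rewrite ?eqxx.
by rewrite add0n H.
Qed.

Lemma square_mod8 (z : int) : exists k : int,
  [\/ z ^+ 2 = 8 * k, z ^+ 2 = 8 * k + 1 | z ^+ 2 = 8 * k + 4].
Proof.
have [b [->|->]] : exists b, z = 2 * b \/ z = 2 * b + 1.
- by exists (z %/ 2)%Z; lia.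
- have [d [->|->]] : exists d, b = 2 * d \/ b = 2 * d + 1.
  + by exists (b %/ 2)%Z; lia.
  + by exists (2 * d ^+ 2); apply: Or31; ring.
  + by exists (2 * d ^+ 2 + 2 * d); apply: Or33; ring.
- have [d hd] : exists d, b * (b + 1) = 2 * d.
    have [d [->|->]] : exists d, b = 2 * d \/ b = 2 * d + 1.
    + by exists (b %/ 2)%Z; lia.
    + by exists (d * (2 * d + 1)); ring.
    + by exists ((2 * d + 1) * (d + 1)); ring.
  by exists d; apply: Or32; rewrite (_ : 8 * d = 4 * (2 * d)); [rewrite -hd; ring|ring].
Qed.

Lemma square_quotient (a y z : int) : z != 0 -> a * z ^+ 2 = y ^+ 2 ->
  exists w : int, a = w ^+ 2.
Proof.
move=> z0 e.
have : (z ^+ 2 %| y ^+ 2)%Z by rewrite -e dvdz_mull.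
rewrite dvdz_pexp2r // => /dvdzP[w hw]; exists w.
by apply: (@mulIf _ (z ^+ 2)); [rewrite expf_neq0|rewrite e hw exprMn].
Qed.

Lemma even_logn_coprime_factor (l : nat) (x y z : int) : prime l -> x * y = z ^+ 2 \/ x * y = - z ^+ 2 ->
  x != 0 -> y != 0 -> ~~ (l%:Z %| x)%Z -> (2 %| logn l `|y|)%N.
Proof.
move=> pl e x0 y0 nx.
have : (`|x| * `|y| = `|z| ^ 2)%N.
  by rewrite -abszM -abszX; case: e => ->; rewrite ?abszN.
move/(congr1 (logn l)); rewrite lognM ?absz_gt0 // lognX.
have -> : logn l `|x| = 0%N.
  by apply/eqP; rewrite -leqn0 leqNgt logn_gt0 mem_primes pl absz_gt0 x0 /=; exact: nx.
by rewrite add0n => ->; exact: dvdn_mulr.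
Qed.

(** A prime other than 3 that divides [y] does not divide [x], so its exponent in [y] is its even
    exponent in [z ^ 2]. *)
Lemma square_cofactor (x y z : int) :
  x * y = z ^+ 2 \/ x * y = - z ^+ 2 -> x != 0 -> 0 < y ->
  (forall l, prime l -> (l%:Z %| x)%Z -> (l%:Z %| y)%Z -> l = 3%N) ->
  exists w : int, y = w ^+ 2 \/ 3 * y = w ^+ 2.
Proof.
move=> e x0 y0 H.
have [|l pl l3|w hw] := @square_up_to_prime 3 `|y| isT.
- by rewrite absz_gt0 gt_eqF.
- have [ly|nly] := boolP (l%:Z %| y)%Z; last first.
    suff -> : logn l `|y| = 0%N by [].
    apply/eqP; rewrite -leqn0 leqNgt logn_gt0 mem_primes pl absz_gt0 gt_eqF //=.
  apply: (even_logn_coprime_factor pl e x0); first by rewrite gt_eqF.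
  by apply/negP => lx; rewrite (H l pl lx ly) in l3.
by exists w%:Z; case: hw => hw; [left|right]; have := congr1 Posz hw;
  rewrite ?PoszM /exprz ?abszE ?gtr0_norm // => ->; rewrite -PoszM mulnn.
Qed.

Lemma cubic_odd (A y : int) : (exists k, A = 2 * k + 1) ->
  A ^+ 3 - 1728 = y ^+ 2 \/ A ^+ 3 - 1728 = - y ^+ 2 -> False.
Proof.
move=> [k hA] e.
have f : A ^+ 3 - 1728 = (A - 12) * (A ^+ 2 + 12 * A + 144) by ring.
rewrite f in e.
have [|||w hw] := square_cofactor e.
- by lia.
- nia.
- move=> l pl /dvdzP[u hu] /dvdzP[v hv].
  have h : (l%:Z %| 432)%Z.
    (* The second factor equals [(A - 12) * (A + 24) + 432]; it is odd, so of the primes 2 and 3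
       only 3 can be common. *)
    apply/dvdzP; exists (v - u * (A + 24)).
    by rewrite mulrBl -hv mulrAC -hu; ring.
  have : (l %| 432)%N by [].
  rewrite (_ : 432 = 2 ^ 4 * 3 ^ 3)%N // Euclid_dvdM // !Euclid_dvdX // !dvdn_prime2 //.
  case/orP => /andP[/eqP l2 _] //.
  by move: hv; rewrite l2 hA; lia.
(* The second factor is 5 mod 8 and its triple is 7 mod 8; neither is a square. *)
have [m hm] := square_mod8 w.
have [k' hk] : exists k' : int, A ^+ 2 = 8 * k' + 1.
  by have [k' [h|h|h]] := square_mod8 A; exists k' => //; move: h; rewrite hA; lia.
by rewrite hk hA in hw; case: hm => hm; rewrite hm in hw; lia.
Qed.

Lemma cubic_div16 (A y : int) : (16 %| A)%Z ->
  A ^+ 3 - 1728 = y ^+ 2 \/ A ^+ 3 - 1728 = - y ^+ 2 -> False.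
Proof.
move=> /dvdzP[B hA] e.
have f : A ^+ 3 - 1728 = 8 ^+ 2 * ((4 * B - 3) * (16 * B ^+ 2 + 12 * B + 9)).
  by rewrite hA; ring.
(* Up to sign [y ^ 2] is 64 times the product of the two factors; the witness finds the sign by
   testing which equation holds. *)
have [z hz] : exists z, y = z * 8.
  apply/dvdzP; rewrite -(@dvdz_pexp2r _ _ 2) //.
  by apply/dvdzP; exists (if y ^+ 2 == A ^+ 3 - 1728 then (4 * B - 3) * (16 * B ^+ 2 + 12 * B + 9)
     else - ((4 * B - 3) * (16 * B ^+ 2 + 12 * B + 9))); case: eqP e => [-> _|h [/esym//|]];
     rewrite f ?mulNr (mulrC (_ ^+ 2)) // => ->; rewrite opprK.
have {f}e : (4 * B - 3) * (16 * B ^+ 2 + 12 * B + 9) = z ^+ 2 \/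
     (4 * B - 3) * (16 * B ^+ 2 + 12 * B + 9) = - z ^+ 2.
  by rewrite f hz in e; case: e => e; [left|right]; nia.
have [|||w hw] := square_cofactor e.
- by lia.
- nia.
- move=> l pl /dvdzP[u hu] /dvdzP[v hv].
  have h : (l%:Z %| 27)%Z.
    (* The second factor equals [(4 * B - 3) * (4 * B + 6) + 27]. *)
    apply/dvdzP; exists (v - u * (4 * B + 6)).
    by rewrite mulrBl -hv mulrAC -hu; ring.
  have : (l %| 27)%N by [].
  by rewrite (_ : 27 = 3 ^ 3)%N // Euclid_dvdX // dvdn_prime2 // => /andP[/eqP].
have [m hm] := square_mod8 w.
set B2 := B ^+ 2 in hw e.
(* Modulo 8 the second factor is [4 * B + 1] and its triple is [4 * B + 3]: only the former can be a
   square, and then [B] is even. *)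
have [hw' [b hb]] : 16 * B2 + 12 * B + 9 = w ^+ 2 /\ exists b, B = 2 * b.
  case: hw => hw'; last by exfalso; case: hm => hm; rewrite hm in hw'; lia.
  split => //.
  have : (2 %| B)%Z by case: hm => hm; rewrite hm in hw'; lia.
  by case/dvdzP => b ->; exists b; rewrite mulrC.
have w0 : w != 0 by apply/eqP => w0; rewrite w0 in hw'; lia.
rewrite hw' in e.
(* For even [B], [4 * B - 3] is 5 mod 8 and its opposite is 3 mod 8, so neither can be the square
   obtained here. *)
have [v hv] : exists v : int, 4 * B - 3 = v ^+ 2 \/ - (4 * B - 3) = v ^+ 2.
  case: e => e; first by have [v hv] := square_quotient w0 e; exists v; left.
  have [|v hv] := @square_quotient (- (4 * B - 3)) z w w0; last by exists v; right.
  by rewrite mulNr e opprK.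
have [n hn] := square_mod8 v.
by case: hv => hv; case: hn => hn; rewrite hn hb in hv; lia.
Qed.

(** * Quadratic orders *)

(* The order Z[w] with w^2 = t w - c, the pair (a, b) standing for a + b w. *)
Definition quad (t c : int) : Type := (int * int)%type.
HB.instance Definition _ t c := GRing.Zmodule.copy (quad t c) (int * int)%type.

Section QuadRing.
Variables t c : int.
Implicit Types x y z : quad t c.

Definition quad1 : quad t c := (1, 0).
Definition quad_mul x y : quad t c :=
  (x.1 * y.1 - c * (x.2 * y.2), x.1 * y.2 + x.2 * y.1 + t * (x.2 * y.2)).

Lemma quad_mulA : associative quad_mul.
Proof. by move=> [a b] [a' b'] [a'' b'']; congr pair => /=; ring. Qed.
Lemma quad_mulC : commutative quad_mul.
Proof. by move=> [a b] [a' b']; congr pair => /=; ring. Qed.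
Lemma quad_mul1 : left_id quad1 quad_mul.
Proof. by move=> [a b]; congr pair => /=; ring. Qed.
Lemma quad_mulDl : left_distributive quad_mul +%R.
Proof. by move=> [a b] [a' b'] [a'' b'']; congr pair => /=; ring. Qed.
Lemma quad1_neq0 : quad1 != 0. Proof. by []. Qed.

HB.instance Definition _ := GRing.Zmodule_isComNzRing.Build (quad t c)
  quad_mulA quad_mulC quad_mul1 quad_mulDl quad1_neq0.

(** The conjugate of [w] is [t - w], and their product is [c]; this is the product of [x] and its
    conjugate. *)
Definition qnorm x : int := x.1 ^+ 2 + t * (x.1 * x.2) + c * x.2 ^+ 2.
Definition qconj x : quad t c := (x.1 + t * x.2, - x.2).

Lemma quad_eta x : x = (x.1, x.2). Proof. by case: x. Qed.
Lemma quad_addE x y : x + y = (x.1 + y.1, x.2 + y.2). Proof. by []. Qed.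
Lemma quad_intE (n : int) : (n%:~R : quad t c) = (n, 0).
Proof.
have H (m : nat) : (m%:R : quad t c) = (m%:Z, 0).
  by elim: m => // m IH; rewrite mulrS IH quad_addE /= -intS addr0.
case: n => n; first by rewrite -pmulrn H.
  by rewrite NegzE mulrNz -pmulrn H; congr pair.
Qed.

Lemma quad_intX (n : int) k : ((n ^+ k)%:~R : quad t c) = n%:~R ^+ k.
Proof. by elim: k => // k IH; rewrite !exprS intrM IH. Qed.

Lemma qnormM x y : qnorm (x * y) = qnorm x * qnorm y.
Proof. by rewrite /qnorm /=; ring. Qed.
Lemma qnorm1 : qnorm 1 = 1. Proof. by rewrite /qnorm /=; ring. Qed.
Lemma qnormX x n : qnorm (x ^+ n) = qnorm x ^+ n.
Proof. by elim: n => [|n IH]; rewrite ?qnorm1 // !exprS qnormM IH. Qed.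
Lemma qnorm_int (n : int) : qnorm n%:~R = n ^+ 2.
Proof. by rewrite quad_intE /qnorm /=; ring. Qed.
Lemma qconjM x y : qconj (x * y) = qconj x * qconj y.
Proof. by congr pair => /=; ring. Qed.
Lemma qconj1 : qconj 1 = 1. Proof. by congr pair => /=; ring. Qed.
Lemma qconjX x n : qconj (x ^+ n) = qconj x ^+ n.
Proof. by elim: n => [|n IH]; rewrite ?qconj1 // !exprS qconjM IH. Qed.
Lemma qconjD x y : qconj (x + y) = qconj x + qconj y.
Proof. by congr pair => /=; ring. Qed.
Lemma qconj_int (n : int) : qconj n%:~R = n%:~R.
Proof. by rewrite quad_intE; congr pair => /=; ring. Qed.
Lemma qconjK : involutive qconj.
Proof. by move=> [a b]; congr pair => /=; ring. Qed.
Lemma mulqconj x : x * qconj x = (qnorm x)%:~R.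
Proof. by rewrite quad_intE; congr pair => /=; rewrite /qnorm; ring. Qed.

(** The difference of the norms is 4 times the trace of [x * qconj y] plus 16 times the norm of
    [y]. *)
Lemma qnormD4 x y : exists k : int, qnorm (x + 4 * y) = qnorm x + 4 * k.
Proof.
exists (2 * (x.1 * y.1) + t * (x.1 * y.2 + x.2 * y.1) + 2 * c * (x.2 * y.2) + 4 * qnorm y).
have -> : (4 : quad t c) = (4, 0) by rewrite -(quad_intE 4).
by rewrite /qnorm /=; ring.
Qed.

(** When [t] is even every trace is even, which gains a factor 2. *)
Lemma qnormD8 x y : (2 %| t)%Z -> exists k : int, qnorm (x + 4 * y) = qnorm x + 8 * k.
Proof.
case/dvdzP => s hs.
exists ((x.1 * y.1) + s * (x.1 * y.2 + x.2 * y.1) + c * (x.2 * y.2) + 2 * qnorm y).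
have -> : (4 : quad t c) = (4, 0) by rewrite -(quad_intE 4).
by rewrite /qnorm /= hs; ring.
Qed.
End QuadRing.

(** * Prime ideals of a quadratic order *)

Lemma dvdz_add (d m n : int) : (d %| m)%Z -> (d %| n)%Z -> (d %| m + n)%Z.
Proof. exact: rpredD. Qed.

Lemma dvdz_sub (d m n : int) : (d %| m)%Z -> (d %| n)%Z -> (d %| m - n)%Z.
Proof. exact: rpredB. Qed.

Lemma prime_part (l : nat) (m : int) : prime l -> m != 0 ->
  exists2 m' : int, ~~ (l%:Z %| m')%Z & m = l%:Z ^+ logn l `|m| * m'.
Proof.
move=> pl m0; have /dvdzP[m' em] : (l%:Z ^+ logn l `|m| %| m)%Z.
  by rewrite dvdzE abszX pfactor_dvdnn.
exists m'; last by rewrite mulrC.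
apply/negP => /dvdzP[k ek].
suff : (logn l `|m| < logn l `|m|)%N by rewrite ltnn.
rewrite -[X in (X < _)%N]/(logn l `|m|) -pfactor_dvdn ?absz_gt0 //.
by rewrite {2}em ek !abszM abszX absz_nat -mulnA -expnS dvdn_mull.
Qed.

Section Primes.
Variables t c : int.
Local Notation O := (quad t c).
Hypothesis aniso : forall x : O, qnorm x = 0 -> x = 0.
Implicit Types (x y z : O) (P : O -> bool) (l : nat).

(** Ideals are boolean predicates, so that membership is decidable; [po_l] places the prime above
    [l]. *)
Record prime_over l P : Prop := PrimeOver {
  po0 : P 0;
  poD : forall x y, P x -> P y -> P (x + y);
  poMl : forall a x, P x -> P (a * x);
  po1 : ~~ P 1;
  po_prime : forall x y, P (x * y) -> P x || P y;
  po_l : P l%:Z%:~R }.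

Lemma intr_mulq (n : int) x : n%:~R * x = (n * x.1, n * x.2) :> O.
Proof. by rewrite quad_intE; congr pair => /=; ring. Qed.

Lemma intr_mulqI (n : int) x y : n != 0 -> n%:~R * x = n%:~R * y -> x = y.
Proof.
move=> n0; rewrite !intr_mulq (quad_eta x) (quad_eta y) => -[] /(mulfI n0) -> /(mulfI n0) ->.
by [].
Qed.

Section Basics.
Variables (l : nat) (P : O -> bool).
Hypotheses (pl : prime l) (pP : prime_over l P).

Lemma poMr a x : P x -> P (x * a). Proof. by rewrite mulrC; exact: (poMl pP). Qed.

Lemma poNM x y : ~~ P x -> ~~ P y -> ~~ P (x * y).
Proof. by move=> nx ny; apply/negP => /(po_prime pP); rewrite (negPf nx) (negPf ny). Qed.

Lemma poNX x n : ~~ P x -> ~~ P (x ^+ n).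
Proof. by move=> nx; elim: n => [|n IH]; [exact: po1 pP|rewrite exprS poNM]. Qed.

Lemma po_int (n : int) : P n%:~R = (l%:Z %| n)%Z.
Proof.
apply/idP/idP => [Pn|/dvdzP[q ->]]; last by rewrite intrM (poMl pP) // (po_l pP).
apply: contraLR (po1 pP) => nl; apply/negPn.
(* If [l] does not divide [n], Bezout writes 1 as a combination of two elements of [P]. *)
have : coprimez l%:Z n.
  by rewrite coprimezE prime_coprime.
case/coprimezP => -[u v] /= e.
rewrite -[1]/(1%:~R) -e intrD !intrM.
by apply: (poD pP); apply: (poMl pP) => //; exact: po_l pP.
Qed.

Lemma po_conj : prime_over l (fun x => P (qconj x)).
Proof.
split.
- by rewrite (_ : qconj 0 = 0) ?(po0 pP) //; congr pair => /=; ring.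
- by move=> x y Px Py; rewrite qconjD (poD pP).
- by move=> a x Px; rewrite qconjM (poMl pP).
- by rewrite qconj1 (po1 pP).
- by move=> x y; rewrite qconjM => /(po_prime pP).
- by rewrite qconj_int (po_l pP).
Qed.

(** Cancel the smaller power of [l]: a factor [l] left on one side would put a product of elements
    outside [P] into [P]. *)
Lemma logn_of_eq (m : int) (e : nat) x y : m != 0 -> ~~ P x -> ~~ P y ->
  m%:~R * x = (l%:Z ^+ e)%:~R * y -> logn l `|m| = e.
Proof.
move=> m0 nx ny E.
have l0 : l%:Z != 0 by rewrite eqz_nat -lt0n prime_gt0.
have [m' hm' em] := prime_part pl m0.
set f := logn l `|m| in em *; clearbody f.
have [lt|lt|//] := ltngtP f e; exfalso.
- move: E; rewrite em -(subnKC (ltnW lt)) exprD !intrM -!mulrA => /intr_mulqI.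
  rewrite expf_neq0 // => /(_ isT) E'.
  have : ~~ P (m'%:~R * x) by rewrite poNM ?po_int.
  rewrite E' quad_intX (_ : (e - f = (e - f).-1.+1)%N) ?exprS; last by lia.
  by rewrite -mulrA poMr // (po_l pP).
- move: E; rewrite em -(subnKC (ltnW lt)) exprD !intrM -!mulrA => /intr_mulqI.
  rewrite expf_neq0 // => /(_ isT) E'.
  move: ny; rewrite -E' quad_intX (_ : (f - e = (f - e).-1.+1)%N) ?exprS; last by lia.
  by rewrite -mulrA poMr // (po_l pP).
Qed.

(** This says without localizing that [l] is a uniformizer at [P]: [z] is [l ^ k] times the [P]-unit
    [y / x]. *)
Hypothesis (unram : forall z, z != 0 -> exists k x y,
  [/\ ~~ P x, ~~ P y & z * x = (l%:Z ^+ k)%:~R * y]).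

(** With [l] a uniformizer, the valuation of [z] at [P] is an integer [k], and that of [m] is
    [n * k] minus [n] times that of [s]. *)
Lemma dvdn_logn_power (m s : int) (n : nat) x y z :
  m != 0 -> s != 0 -> z != 0 -> ~~ P x -> ~~ P y ->
  (m * s ^+ n)%:~R * x = z ^+ n * y -> (n %| logn l `|m|)%N.
Proof.
move=> m0 s0 z0 nx ny E; have [k [a [b [na nb E2]]]] := unram z0.
have : (m * s ^+ n)%:~R * (x * a ^+ n) = (l%:Z ^+ (k * n))%:~R * (b ^+ n * y) :> O.
  by rewrite mulrA E mulrAC -exprMn E2 exprMn -quad_intX exprM mulrA.
move/logn_of_eq; rewrite mulf_neq0 ?expf_neq0 // !poNM ?poNX // => /(_ isT isT isT).
rewrite abszM lognM ?absz_gt0 ?expf_neq0 // abszX lognX => e.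
by rewrite -(dvdn_addl _ (dvdn_mulr (logn l `|s|) (dvdnn n))) e dvdn_mull.
Qed.
End Basics.

(** Multiplicativity of the norm gives every ideal axiom except closure under addition, which holds
    when only one prime lies above [l]. *)
Lemma norm_prime_over l : prime l ->
  (forall x y, (l%:Z %| qnorm x)%Z -> (l%:Z %| qnorm y)%Z -> (l%:Z %| qnorm (x + y))%Z) ->
  prime_over l (fun x => (l%:Z %| qnorm x)%Z).
Proof.
move=> pl H; split=> //.
- by rewrite (_ : qnorm 0 = 0) ?dvdz0 // /qnorm /=; ring.
- by move=> a x h; rewrite qnormM dvdz_mull.
- by rewrite qnorm1 dvdz1 /=; apply: contraL pl => /eqP->.
- by move=> x y; rewrite qnormM dvdzE abszM Euclid_dvdM.
- by rewrite qnorm_int dvdz_mulr.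
Qed.

Lemma primitive_part l x : prime l -> x != 0 -> exists k y,
  x = (l%:Z ^+ k)%:~R * y /\ ~~ ((l%:Z %| y.1)%Z && (l%:Z %| y.2)%Z).
Proof.
move=> pl; move: {2}(`|x.1| + `|x.2|)%N (leqnn (`|x.1| + `|x.2|)%N) => n.
elim: n x => [|n IH] x hn x0.
  by move: hn x0; case: x => a b /=; rewrite leqn0 addn_eq0 !absz_eq0 => /andP[/eqP-> /eqP->] /eqP.
have [/andP[/dvdzP[a ha] /dvdzP[b hb]]|h] := boolP ((l%:Z %| x.1)%Z && (l%:Z %| x.2)%Z);
  last by exists 0%N, x; rewrite mul1r.
have ex : x = l%:Z%:~R * ((a, b) : O).
  by rewrite intr_mulq (quad_eta x) ha hb /= ![_ * l%:Z]mulrC.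
have y0 : ((a, b) : O) != 0 by apply: contraNneq x0 => e; rewrite ex e mulr0.
have [|k [y [ey hy]]] := IH (a, b) _ y0.
  have : (0 < `|x.1| + `|x.2|)%N.
    rewrite addn_gt0 !absz_gt0; apply: contraNT x0; rewrite negb_or !negbK => /andP[/eqP e1 /eqP e2].
    by rewrite (quad_eta x) e1 e2.
  have := prime_gt1 pl; rewrite ha hb !abszM absz_nat /= in hn *; nia.
by exists k.+1, y; rewrite ex ey exprS intrM mulrA.
Qed.

(* The ring morphism to F_l that sends the generator to [r]. *)
Definition redq (r : int) x : int := x.1 + x.2 * r.

(** If [X ^ 2 - t X + c] has a root modulo [l], the kernel of the reduction [redq] is a prime of
    degree 1; otherwise [l] is inert and the elements of norm divisible by [l] are the multiples of
    [l]. *)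
Lemma unramified_prime l : prime l -> ~~ (l%:Z %| t ^+ 2 - 4 * c)%Z ->
  exists P, prime_over l P /\ forall z, z != 0 -> exists k x y,
    [/\ ~~ P x, ~~ P y & z * x = (l%:Z ^+ k)%:~R * y].
Proof.
move=> pl nd.
have EM (a b : int) : (l%:Z %| a * b)%Z = (l%:Z %| a)%Z || (l%:Z %| b)%Z.
  by rewrite !dvdzE abszM Euclid_dvdM.
have N1 : ~~ (l%:Z %| 1)%Z by rewrite dvdz1 /=; apply: contraL pl => /eqP->.
have [/existsP[r hr]|] := boolP [exists r : 'I_l, (l%:Z %| r%:Z ^+ 2 - t * r%:Z + c)%Z].
- set s : int := r%:Z in hr; exists (fun x => (l%:Z %| redq s x)%Z).
  have redM x y : (l%:Z %| redq s (x * y) - redq s x * redq s y)%Z.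
    rewrite (_ : redq s (x * y) - redq s x * redq s y =
      - (x.2 * y.2) * (s ^+ 2 - t * s + c)) ?dvdz_mull //.
    by rewrite /redq /=; ring.
  have dM x y : (l%:Z %| redq s (x * y))%Z = (l%:Z %| redq s x)%Z || (l%:Z %| redq s y)%Z.
    by rewrite -EM -[redq s (x * y)](subrK (redq s x * redq s y)) [LHS](rpredDl _ (redM x y)).
  split.
    split=> //.
    - move=> x y hx hy; rewrite (_ : redq s (x + y) = redq s x + redq s y).
        exact: dvdz_add.
      by rewrite /redq /=; ring.
    - by move=> a x h; rewrite dM h orbT.
    - by move=> x y; rewrite dM.
    - by rewrite quad_intE /redq /= mul0r addr0 dvdzz.
  move=> z z0; have [k [y [ez hy]]] := primitive_part pl z0.
  have n1 : ~~ (l%:Z %| redq s 1%R)%Z by rewrite /redq /= mul0r addr0.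
  have [h1|h1] := boolP (l%:Z %| redq s y)%Z; last first.
    by exists k, (1 : O), y; split=> //; rewrite mulr1.
  (* A primitive element of [P] has its conjugate outside [P]: otherwise [l] divides
     [y.2 * (2 * s - t)], and the square of [2 * s - t] is the discriminant modulo [l]. Multiplying
     by the conjugate then turns [y] into its norm. *)
  have nc : ~~ (l%:Z %| redq s (qconj y))%Z.
    apply/negP => h2.
    have h3 : (l%:Z %| y.2 * (2 * s - t))%Z.
      rewrite (_ : y.2 * _ = redq s y - redq s (qconj y)) ?dvdz_sub //.
      by rewrite /redq /=; ring.
    have h4 : (l%:Z %| y.2)%Z.
      move: h3; rewrite EM => /orP[//|h4]; case/negP: nd.
      rewrite (_ : t ^+ 2 - 4 * c = (2 * s - t) * (2 * s - t) - 4 * (s ^+ 2 - t * s + c)).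
        by rewrite dvdz_sub // ?dvdz_mull.
      by ring.
    case/negP: hy; rewrite h4 andbT (_ : y.1 = redq s y - y.2 * s) ?dvdz_sub ?dvdz_mulr //.
    by rewrite /redq; ring.
  have N0 : qnorm y != 0.
    by apply: contraNneq z0 => /aniso y0; rewrite ez y0 mulr0.
  have [e [n [en hn]]] : exists e n, qnorm y = l%:Z ^+ e * n /\ ~~ (l%:Z %| n)%Z.
    have [n hn en] := prime_part pl N0.
    by exists (logn l `|qnorm y|), n.
  exists (k + e)%N, (qconj y), n%:~R; split => //.
    by rewrite quad_intE /redq /= mul0r addr0.
  by rewrite ez -mulrA mulqconj en exprD !intrM mulrA.
rewrite negb_exists => /forallP nr.
have inert x : (l%:Z %| qnorm x)%Z -> (l%:Z %| x.1)%Z && (l%:Z %| x.2)%Z.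
  move=> h; have [h2|h2] := boolP (l%:Z %| x.2)%Z.
    have : (l%:Z %| x.1 * x.1)%Z.
      rewrite (_ : x.1 * x.1 = qnorm x - x.2 * (t * x.1 + c * x.2)) ?dvdz_sub ?dvdz_mulr //.
      by rewrite /qnorm; ring.
    by rewrite EM orbb => ->.
  have : coprimez l%:Z x.2 by rewrite coprimezE prime_coprime.
  case/coprimezP => -[u v] /= e.
  (* Since [v] inverts [x.2] modulo [l], [r] is the residue of [- x.1 / x.2], which would be a
     root. *)
  pose r0 := - x.1 * v; pose r := (r0 %% l%:Z)%Z.
  have r_ge0 : 0 <= r by rewrite modz_ge0 // eqz_nat -lt0n prime_gt0.
  have r_lt : (`|r| < l)%N.
    by rewrite -ltz_nat gez0_abs // ltz_pmod // ltz_nat prime_gt0.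
  case/negP: (nr (Ordinal r_lt)); rewrite /= gez0_abs //.
  have [q eq] : exists q, r = r0 - q * l%:Z.
    by exists (r0 %/ l%:Z)%Z; rewrite {1}(divz_eq r0 l%:Z) addrAC subrr add0r.
  have e' : u * l%:Z = 1 - v * x.2 by rewrite -e addrK.
  rewrite (_ : r ^+ 2 - t * r + c = v ^+ 2 * qnorm x +
     l%:Z * (q ^+ 2 * l%:Z - 2 * q * r0 + t * q + u * (c * (1 + v * x.2) + t * x.1 * v))).
    by apply: dvdz_add; [exact: dvdz_mull|exact: dvdz_mulr].
  rewrite [l%:Z * _]mulrDr [l%:Z * (u * _)]mulrA [l%:Z * u]mulrC e' eq /r0 /qnorm; ring.
exists (fun x => (l%:Z %| qnorm x)%Z); split.
  apply: norm_prime_over => // x y /inert/andP[h1 h2] /inert/andP[h3 h4].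
  have h13 : (l%:Z %| x.1 + y.1)%Z by exact: dvdz_add.
  have h24 : (l%:Z %| x.2 + y.2)%Z by exact: dvdz_add.
  by rewrite /qnorm !(dvdz_add, dvdz_mull _ (dvdz_mull _ h24), dvdz_mull _ h24, dvdz_mulr _ h13).
move=> z z0; have [k [y [ez hy]]] := primitive_part pl z0.
exists k, (1 : O), y; split; rewrite ?qnorm1 ?mulr1 //.
by apply: contra hy => /inert.
Qed.
End Primes.

(** * Integral models *)

(** The coefficient type is arbitrary, so that models over the order and over [algC] share one set
    of formulas. *)
Record wmodel (R : Type) := WModel { m1 : R; m2 : R; m3 : R; m4 : R; m6 : R }.

Section Invariants.
Variable R : comNzRingType.
Implicit Type W : wmodel R.

Definition mb2 W := m1 W ^+ 2 + 4 * m2 W.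
Definition mb4 W := 2 * m4 W + m1 W * m3 W.
Definition mb6 W := m3 W ^+ 2 + 4 * m6 W.
Definition mb8 W := m1 W ^+ 2 * m6 W + 4 * m2 W * m6 W - m1 W * m3 W * m4 W
  + m2 W * m3 W ^+ 2 - m4 W ^+ 2.
Definition mc4 W := mb2 W ^+ 2 - 24 * mb4 W.
Definition mc6 W := - mb2 W ^+ 3 + 36 * mb2 W * mb4 W - 216 * mb6 W.
Definition mdisc W := - mb2 W ^+ 2 * mb8 W - 8 * mb4 W ^+ 3 - 27 * mb6 W ^+ 2
  + 9 * mb2 W * mb4 W * mb6 W.

Lemma mc4_mc6_mdisc W : mc4 W ^+ 3 - mc6 W ^+ 2 = 1728 * mdisc W.
Proof. by rewrite /mc4 /mc6 /mdisc /mb8 /mb2 /mb4 /mb6; ring. Qed.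

(** The change of variables with [u = 1 / s], written without division; it clears denominators. *)
Definition wscale W (s : R) :=
  WModel (s * m1 W) (s ^+ 2 * m2 W) (s ^+ 3 * m3 W) (s ^+ 4 * m4 W) (s ^+ 6 * m6 W).

Lemma mc4_scale W s : mc4 (wscale W s) = s ^+ 4 * mc4 W.
Proof. by rewrite /mc4 /mb2 /mb4 /=; ring. Qed.
Lemma mc6_scale W s : mc6 (wscale W s) = s ^+ 6 * mc6 W.
Proof. by rewrite /mc6 /mb2 /mb4 /mb6 /=; ring. Qed.
Lemma mdisc_scale W s : mdisc (wscale W s) = s ^+ 12 * mdisc W.
Proof. by rewrite /mdisc /mb8 /mb2 /mb4 /mb6 /=; ring. Qed.
End Invariants.

Definition wmap (R S : Type) (f : R -> S) (W : wmodel R) :=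
  WModel (f (m1 W)) (f (m2 W)) (f (m3 W)) (f (m4 W)) (f (m6 W)).

Definition weier_model (E : weier) : wmodel algC :=
  WModel (a1 E) (a2 E) (a3 E) (a4 E) (a6 E).

Lemma discE E : disc E = mdisc (weier_model E). Proof. by []. Qed.

Section Change.
Variables (E : weier) (u r s t : algC).
Hypothesis u0 : u != 0.
Lemma mc4_change : mc4 (weier_model E) = u ^+ 4 * mc4 (weier_model (change E u r s t)).
Proof. by rewrite /mc4 /mb2 /mb4 /=; field. Qed.
Lemma mc6_change : mc6 (weier_model E) = u ^+ 6 * mc6 (weier_model (change E u r s t)).
Proof. by rewrite /mc6 /mb2 /mb4 /mb6 /=; field. Qed.
Lemma mdisc_change : mdisc (weier_model E) = u ^+ 12 * mdisc (weier_model (change E u r s t)).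
Proof. by rewrite /mdisc /mb8 /mb2 /mb4 /mb6 /=; field. Qed.
End Change.

(** * Passage from curves over the field to integral models over the order *)

Section Embedding.
Variables (t c d : int) (w : algC).
Local Notation O := (quad t c).
Hypothesis aniso : forall x : O, qnorm x = 0 -> x = 0.
Hypothesis wE : w ^+ 2 = t%:~R * w - c%:~R.

Definition emb (x : O) : algC := x.1%:~R + x.2%:~R * w.

Lemma embD x y : emb (x + y) = emb x + emb y.
Proof. by rewrite /emb /= !intrD; ring. Qed.
Lemma embN x : emb (- x) = - emb x.
Proof. by rewrite /emb /= !intrN; ring. Qed.
Lemma embM x y : emb (x * y) = emb x * emb y.
Proof.
rewrite /emb /= !(intrD, intrM, intrN).
have h : w ^+ 2 - (t%:~R * w - c%:~R) = 0 by rewrite wE subrr.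
(* The two sides differ by [x.2 * y.2] times the relation satisfied by [w]. *)
by rewrite -[LHS]subr0 -(mulr0 (- (x.2%:~R * y.2%:~R))) -h; ring.
Qed.
Lemma emb_int (n : int) : emb n%:~R = n%:~R.
Proof. by rewrite quad_intE /emb /= mul0r addr0. Qed.
Lemma emb_nat (n : nat) : emb n%:R = n%:R.
Proof. by rewrite [n%:R]pmulrn emb_int. Qed.
Lemma emb1 : emb 1 = 1. Proof. exact: (emb_nat 1). Qed.
Lemma emb0 : emb 0 = 0. Proof. exact: (emb_nat 0). Qed.
Lemma embX x n : emb (x ^+ n) = emb x ^+ n.
Proof. by elim: n => [|n IH]; rewrite ?emb1 // !exprS embM IH. Qed.
(** The norm of [x] is [emb x * emb (qconj x)], so it vanishes with [emb x]. *)
Lemma emb_eq0 x : emb x = 0 -> x = 0.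
Proof.
move=> e; apply: aniso; apply/eqP; rewrite -(intr_eq0 algC) -emb_int -mulqconj embM e mul0r //.
Qed.
Lemma emb_inj : injective emb.
Proof. by move=> x y e; apply/eqP; rewrite -subr_eq0; apply/eqP/emb_eq0; rewrite embD embN e subrr. Qed.

Lemma emb_mc4 W : emb (mc4 W) = mc4 (wmap emb W).
Proof. by rewrite /mc4 /mb2 /mb4 !(emb_nat, embX, embM, embN, embD). Qed.
Lemma emb_mc6 W : emb (mc6 W) = mc6 (wmap emb W).
Proof. by rewrite /mc6 /mb2 /mb4 /mb6 !(emb_nat, embX, embM, embN, embD). Qed.
Lemma emb_mdisc W : emb (mdisc W) = mdisc (wmap emb W).
Proof. by rewrite /mdisc /mb8 /mb2 /mb4 /mb6 !(emb_nat, embX, embM, embN, embD). Qed.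

Hypothesis inOKE : forall z, inOK d z <-> exists x, z = emb x.
Hypothesis inKE : forall z, inQuadField d z -> exists x (s : int), s != 0 /\ z * s%:~R = emb x.

Definition emb_ideal (P : O -> bool) (z : algC) : Prop := exists2 x, P x & z = emb x.

Lemma emb_idealE (P : O -> bool) x : emb_ideal P (emb x) -> P x.
Proof. by case=> y Py /emb_inj ->. Qed.

Lemma emb_prime_ideal l P : prime l -> prime_over l P -> is_prime_ideal d (emb_ideal P).
Proof.
move=> pl pP; split; first by move=> _ [x _ ->]; apply/inOKE; exists x.
split; first by exists 0; rewrite ?emb0 ?(po0 pP).
split; first by move=> _ _ [x Px ->] [y Py ->]; exists (x + y); rewrite ?embD ?(poD pP).
split.
  move=> a _ /inOKE[b ->] [x Px ->]; exists (b * x); rewrite ?embM //; exact: poMl pP _ _ Px.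
split; first by rewrite -emb1 => /emb_idealE; apply/negP; exact: po1 pP.
split.
  move=> _ _ /inOKE[x ->] /inOKE[y ->]; rewrite -embM => /emb_idealE /(po_prime pP) /orP[h|h];
  by [left; exists x|right; exists y].
exists l%:R; split; first by exists l%:Z%:~R; rewrite ?(po_l pP) // emb_int -pmulrn.
by rewrite pnatr_eq0 -lt0n prime_gt0.
Qed.

Lemma Pintegral_emb P z : Pintegral d (emb_ideal P) z ->
  exists x y, ~~ P y /\ z = emb x / emb y.
Proof.
case=> _ [_ [/inOKE[x ->] /inOKE[y ->] h ->]]; exists x, y; split => //.
by apply/negP => Py; apply: h; exists y.
Qed.

(** Take for [s] the product of the five denominators; it stays outside [P] because [P] is prime. *)
Lemma common_denominator l P (E : weier) : prime_over l P ->
  let I := Pintegral d (emb_ideal P) in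
  I (a1 E) -> I (a2 E) -> I (a3 E) -> I (a4 E) -> I (a6 E) ->
  exists s W, ~~ P s /\ wmap emb W = wscale (weier_model E) (emb s).
Proof.
move=> pP I /Pintegral_emb[x1 [y1 [n1 e1]]] /Pintegral_emb[x2 [y2 [n2 e2]]]
  /Pintegral_emb[x3 [y3 [n3 e3]]] /Pintegral_emb[x4 [y4 [n4 e4]]] /Pintegral_emb[x6 [y6 [n6 e6]]].
have nz y : ~~ P y -> emb y != 0.
  by move=> ny; apply: contraNneq ny => /emb_eq0->; exact: po0 pP.
exists (y1 * y2 * y3 * y4 * y6).
pose s := y1 * y2 * y3 * y4 * y6.
exists (WModel (x1 * (y2 * y3 * y4 * y6)) (s * (x2 * (y1 * y3 * y4 * y6)))
  (s ^+ 2 * (x3 * (y1 * y2 * y4 * y6))) (s ^+ 3 * (x4 * (y1 * y2 * y3 * y6)))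
  (s ^+ 5 * (x6 * (y1 * y2 * y3 * y4)))).
split; first by do !apply: (poNM pP) => //.
rewrite /wmap /wscale /s /= e1 e2 e3 e4 e6 !(embM, embX).
by congr WModel; field; rewrite ?nz.
Qed.

(** Here [x / s] stands for [u / v], where [u] scales to the good model and [v] clears its
    denominators; multiplying by the conjugate of [v] makes the denominator [s] an integer. *)
Lemma local_model l P (E : weier) : prime l -> prime_over l P ->
  good_reduction_at d E (emb_ideal P) ->
  exists (W : wmodel O) (x : O) (s : int), [/\ x != 0, s != 0 & ~~ P (mdisc W)] /\
    [/\ s%:~R ^+ 4 * mc4 (weier_model E) = emb (x ^+ 4 * mc4 W),
        s%:~R ^+ 6 * mc6 (weier_model E) = emb (x ^+ 6 * mc6 W) &
        s%:~R ^+ 12 * mdisc (weier_model E) = emb (x ^+ 12 * mdisc W)].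
Proof.
move=> pl pP [u [r [s [q [/inKE[y [k [k0 ek]]] [u0 [_ [_ [_]]]]]]]]].
set E' := change E u r s q => -[i1 [i2 [i3 [i4 [i6 [D0 [_ /Pintegral_emb[a [b [nb eD]]]]]]]]]].
have [v [W [nv eW]]] := common_denominator pP i1 i2 i3 i4 i6.
have nz z : ~~ P z -> emb z != 0.
  by move=> nz; apply: contraNneq nz => /emb_eq0->; exact: po0 pP.
have v0 := nz _ nv.
have Nv : emb v * emb (qconj v) = (qnorm v)%:~R by rewrite -embM mulqconj emb_int.
have N0 : qnorm v != 0 by apply: contraNneq v0 => /aniso->; rewrite emb0.
have k0' : (k%:~R : algC) != 0 by rewrite intr_eq0.
have y0 : emb y != 0 by rewrite -ek mulf_neq0.
have vc0 : emb (qconj v) != 0.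
  by apply: contraNneq N0 => e; rewrite -(intr_eq0 algC) -Nv e mulr0.
exists W, (y * qconj v), (k * qnorm v); split; first split.
- by apply/eqP => /(congr1 emb) /eqP; rewrite embM emb0 mulf_eq0 (negPf y0) (negPf vc0).
- by rewrite mulf_neq0.
(* The inverse of the good discriminant is [a / b] with [b] outside [P], whence
   [a * mdisc W = v ^+ 12 * b], which is outside [P]. *)
- apply/negP => h.
  have : P (a * mdisc W) by exact: (poMl pP).
  rewrite (_ : a * mdisc W = v ^+ 12 * b) => [|].
    by apply/negP; rewrite (poNM pP) ?(poNX pP).
  apply: emb_inj; rewrite [LHS]embM [RHS]embM embX emb_mdisc eW mdisc_scale -discE.
  have -> : emb a = (disc E')^-1 * emb b by rewrite eD mulfVK ?nz.
  by rewrite mulrC -mulrA mulVKf.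
- have H n z z' : emb z = emb v ^+ n * z' ->
    (k * qnorm v)%:~R ^+ n * (u ^+ n * z') = emb ((y * qconj v) ^+ n * z).
    move=> ez; rewrite embM embX embM ez -ek intrM -Nv !exprMn; ring.
  split.
  + rewrite (mc4_change E r s q u0) -/E'; apply: (H 4%N).
    by rewrite emb_mc4 eW mc4_scale.
  + rewrite (mc6_change E r s q u0) -/E'; apply: (H 6%N).
    by rewrite emb_mc6 eW mc6_scale.
  + rewrite (mdisc_change E r s q u0) -/E'; apply: (H 12%N).
    by rewrite emb_mdisc eW mdisc_scale.
Qed.

(** The trace of everywhere good reduction on the invariants alone, inside the order; [x / s] plays
    the role of the scaling [u]. *)
Definition good_models (A : wmodel O) : Prop :=
  forall l P, prime l -> prime_over l P ->
  exists (W : wmodel O) (x : O) (s : int), [/\ x != 0, s != 0 & ~~ P (mdisc W)] /\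
    [/\ s%:~R ^+ 4 * mc4 A = x ^+ 4 * mc4 W,
        s%:~R ^+ 6 * mc6 A = x ^+ 6 * mc6 W &
        s%:~R ^+ 12 * mdisc A = x ^+ 12 * mdisc W].

(** [A] is [E] scaled by the product [b] of integer denominators of its coefficients; [b] is
    absorbed into [x]. *)
Lemma integral_good_models (E : weier) : ell_curve_over d E -> everywhere_good d E ->
  exists A : wmodel O, [/\ good_models A, mdisc A != 0 &
    jinv E * emb (mdisc A) = emb (mc4 A) ^+ 3].
Proof.
case=> /inKE[x1 [s1 [n1 e1]]] [/inKE[x2 [s2 [n2 e2]]]] [/inKE[x3 [s3 [n3 e3]]]]
  [/inKE[x4 [s4 [n4 e4]]]] [/inKE[x6 [s6 [n6 e6]]]] D0 EG.
pose b : int := s1 * s2 * s3 * s4 * s6.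
have b0 : b != 0 by rewrite !mulf_neq0.
pose q (n : int) : O := n%:~R.
pose A := WModel (x1 * q (s2 * s3 * s4 * s6)) (q b * (x2 * q (s1 * s3 * s4 * s6)))
  (q b ^+ 2 * (x3 * q (s1 * s2 * s4 * s6))) (q b ^+ 3 * (x4 * q (s1 * s2 * s3 * s6)))
  (q b ^+ 5 * (x6 * q (s1 * s2 * s3 * s4))).
have eA : wmap emb A = wscale (weier_model E) b%:~R.
  rewrite /wmap /wscale /A /q /= !(embM, embX, emb_int) -e1 -e2 -e3 -e4 -e6 /b !intrM.
  by congr WModel; ring.
have eD : emb (mdisc A) = b%:~R ^+ 12 * disc E by rewrite emb_mdisc eA mdisc_scale.
have e4' : emb (mc4 A) = b%:~R ^+ 4 * wc4 E by rewrite emb_mc4 eA mc4_scale.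
have e6' : emb (mc6 A) = b%:~R ^+ 6 * mc6 (weier_model E) by rewrite emb_mc6 eA mc6_scale.
exists A; split.
- move=> l P pl pP.
  have [W [x [s [[x0 s0 nP] [h4 h6 hD]]]]] :=
    local_model pl pP (EG _ (emb_prime_ideal pl pP)).
  exists W, (x * b%:~R), s; split; first split => //.
    by apply: contraNneq x0 => /(congr1 emb); rewrite embM emb0 emb_int => /eqP;
       rewrite mulf_eq0 intr_eq0 (negPf b0) orbF => /eqP/emb_eq0->.
  have H n z z' z'' : s%:~R ^+ n * z' = emb (x ^+ n * z'') -> emb z = b%:~R ^+ n * z' ->
     s%:~R ^+ n * z = (x * b%:~R) ^+ n * z''.
    move=> h hz; apply: emb_inj; rewrite [LHS]embM embX emb_int hz mulrCA h.
    by rewrite [LHS]mulrC [in RHS]embM embX [emb (x * _)]embM emb_int embM embX exprMn; ring.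
  by split; [exact: (H 4%N) h4 e4'|exact: (H 6%N) h6 e6'|exact: (H 12%N) hD eD].
- by apply/eqP => h; move: eD; rewrite h emb0 => /esym/eqP; rewrite mulf_eq0 expf_eq0 intr_eq0 (negPf b0) andbF (negPf D0).
- by rewrite eD e4' /jinv; field.
Qed.
End Embedding.

(** * Norms of the invariants *)

Lemma logn_notdvd (l : nat) (m : int) : prime l -> ~~ (l%:Z %| m)%Z -> logn l `|m| = 0%N.
Proof.
move=> pl h; apply/eqP; rewrite -leqn0 leqNgt logn_gt0 mem_primes.
by apply/negP => /and3P[_ _]; apply/negP.
Qed.

Lemma PoszX (m n : nat) : (m ^ n)%N = m%:Z ^+ n :> int.
Proof. by elim: n => // n IH; rewrite expnS PoszM IH exprS. Qed.

Lemma abs_power (n : nat) (m : int) : m != 0 -> (0 < n)%N ->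
  (forall l, prime l -> n %| logn l `|m|)%N -> exists2 r : int, r != 0 & `|m| = r ^+ n.
Proof.
move=> m0 n0 /perfect_power []; rewrite ?absz_gt0 // => r hr.
have e : `|m| = r%:Z ^+ n by rewrite -abszE hr PoszX.
by exists r%:Z => //; apply: contraNneq m0 => r0; rewrite -normr_eq0 e r0 expr0n gtn_eqF.
Qed.

Lemma lognXM (l n : nat) (a u : int) : a != 0 -> u != 0 ->
  logn l `|(a ^+ n * u)%R| = (n * logn l `|a| + logn l `|u|)%N.
Proof. by move=> a0 u0; rewrite abszM lognM ?absz_gt0 ?expf_neq0 // abszX lognX. Qed.

Lemma odd64 (b : int) : ~~ (2 %| 64 * b - 27)%Z. Proof. by lia. Qed.

Lemma odd_int (b : int) : ~~ (2 %| b)%Z -> exists k, b = 2 * k + 1.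
Proof. by exists (b %/ 2)%Z; lia. Qed.

(** * Valuations of j, of j - 1728 and of the norm of the discriminant *)

Section GlobalArgument.
Variables (t c : int) (p : nat).
Local Notation O := (quad t c).
Hypothesis aniso : forall x : O, qnorm x = 0 -> x = 0.
Hypothesis pp : prime p.
Hypothesis ramified : forall l, prime l -> (l%:Z %| t ^+ 2 - 4 * c)%Z -> l = 2%N \/ l = p.
(** This expresses that a single prime lies above 2 and above [p]: ramified, or inert for 2 in the
    imaginary case. *)
Hypothesis norm_ideal : forall l, l = 2%N \/ l = p -> forall x y : O,
  (l%:Z %| qnorm x)%Z -> (l%:Z %| qnorm y)%Z -> (l%:Z %| qnorm (x + y))%Z.

Lemma qnorm0 : qnorm (0 : O) = 0.
Proof. by rewrite /qnorm /=; ring. Qed.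

Lemma qmulfI (x y z : O) : x != 0 -> x * y = x * z -> y = z.
Proof.
move=> x0 e; have n0 : qnorm x != 0 by apply: contraNneq x0 => /aniso->.
by apply: (intr_mulqI n0); rewrite -mulqconj mulrC mulrA (mulrC y) e mulrAC.
Qed.

Lemma qmulf_neq0 (x y : O) : x != 0 -> y != 0 -> x * y != 0.
Proof. by move=> x0; apply: contraNneq => e; apply/eqP/(qmulfI x0); rewrite e mulr0. Qed.

Lemma qnorm_neq0 (x : O) : x != 0 -> qnorm x != 0.
Proof. by apply: contraNneq => /aniso->. Qed.

Lemma qexpf_neq0 (x : O) n : x != 0 -> x ^+ n != 0.
Proof. by move=> x0; elim: n => [|n IH]; rewrite ?oner_neq0 // exprS qmulf_neq0. Qed.

Lemma mul_scaled (a b x y x' y' z z' : O) n :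
  a ^+ n * y = x ^+ n * z -> b ^+ n * y' = x' ^+ n * z' ->
  y * y' * (a * b) ^+ n = (x * x') ^+ n * (z * z').
Proof. by move=> e e'; rewrite mulrC !exprMn mulrACA e e' mulrACA. Qed.

Lemma qnorm_scaled (s : int) (x y z : O) n : s%:~R ^+ n * y = x ^+ n * z ->
  (s ^+ 2) ^+ n * qnorm y = qnorm x ^+ n * qnorm z.
Proof. by move/(congr1 (@qnorm t c)); rewrite !qnormM !qnormX qnorm_int. Qed.

Lemma qconj_scaled (s : int) (x y z : O) n : s%:~R ^+ n * y = x ^+ n * z ->
  s%:~R ^+ n * qconj y = qconj x ^+ n * qconj z.
Proof. by move/(congr1 (@qconj t c)); rewrite !qconjM !qconjX qconj_int. Qed.

Definition qnormal (l : nat) (x : O) : bool := (l%:Z %| qnorm x)%Z.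

Lemma prime_cases l : prime l ->
  ((l = 2%N \/ l = p) /\ prime_over l (qnormal l)) \/
  exists2 P : O -> bool, prime_over l P & forall z : O, z != 0 -> exists k x y,
    [/\ ~~ P x, ~~ P y & z * x = (l%:Z ^+ k)%:~R * y].
Proof.
move=> pl; have [/(ramified pl) r|/(unramified_prime aniso pl)[P [h1 h2]]] :=
  boolP (l%:Z %| t ^+ 2 - 4 * c)%Z; last by right; exists P.
by left; split => //; apply: norm_prime_over => //; exact: norm_ideal.
Qed.

Variable A : wmodel O.
Hypothesis good : good_models A.
Hypothesis D0 : mdisc A != 0.

(** Both sides of the relation have weight 12, so it passes to every rescaled model. *)
Lemma transfer4 (W : wmodel O) (x : O) (s u v : int) : x != 0 -> s != 0 ->
  s%:~R ^+ 4 * mc4 A = x ^+ 4 * mc4 W -> s%:~R ^+ 12 * mdisc A = x ^+ 12 * mdisc W ->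
  u%:~R * mdisc A = v%:~R * mc4 A ^+ 3 -> u%:~R * mdisc W = v%:~R * mc4 W ^+ 3.
Proof.
move=> x0 s0 e4 eD e; apply: (qmulfI (qexpf_neq0 12 x0)).
have eM (y z : O) : y ^+ 12 * z ^+ 3 = (y ^+ 4 * z) ^+ 3 by rewrite exprMn -exprM.
by rewrite mulrCA -eD mulrCA e mulrCA [RHS]mulrCA (eM s%:~R (mc4 A)) (eM x (mc4 W)) e4.
Qed.

(** The invariant j is [u / v]. A prime factor of [v] would, at a good model whose discriminant lies
    outside [P], also divide [u]. *)
Lemma integral_jinv (u v : int) : v != 0 -> coprimez u v ->
  u%:~R * mdisc A = v%:~R * mc4 A ^+ 3 -> `|v|%N = 1%N.
Proof.
move=> v0 cuv e; apply/eqP/negPn/negP => v1.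
set l := pdiv `|v|%N.
have pl : prime l by apply: pdiv_prime; rewrite ltn_neqAle eq_sym v1 absz_gt0.
have lv : (l%:Z %| v)%Z by exact: pdiv_dvd.
have [P pP] : exists P : O -> bool, prime_over l P.
  by have [[_ h]|[P h _]] := prime_cases pl; [exists (qnormal l)|exists P].
have [W [x [s [[x0 s0 nP] [e4 _ eD]]]]] := good pl pP.
have eW := transfer4 x0 s0 e4 eD e.
have : P (u%:~R * mdisc W) by rewrite eW mulrC (poMl pP) // (po_int pl pP).
move=> /(po_prime pP); rewrite (negPf nP) orbF (po_int pl pP) => lu.
have : (l%:Z %| gcdz u v)%Z by rewrite dvdz_gcd lu.
by rewrite (eqP cuv) dvdz1 /=; apply/negP; apply: contraL pl => /eqP->.
Qed.

Variable j : int.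
Hypothesis jE : j%:~R * mdisc A = mc4 A ^+ 3.

Lemma transferj (W : wmodel O) (x : O) (s : int) : x != 0 -> s != 0 ->
  s%:~R ^+ 4 * mc4 A = x ^+ 4 * mc4 W -> s%:~R ^+ 12 * mdisc A = x ^+ 12 * mdisc W ->
  j%:~R * mdisc W = mc4 W ^+ 3 /\ (j - 1728)%:~R * mdisc W = mc6 W ^+ 2.
Proof.
move=> x0 s0 e4 eD.
have e : j%:~R * mdisc W = mc4 W ^+ 3.
  by rewrite (transfer4 x0 s0 e4 eD (v := 1)) ?mul1r.
split => //; rewrite intrB mulrBl e -[in LHS](subrK (mc6 W ^+ 2) (mc4 W ^+ 3)) mc4_mc6_mdisc.
by rewrite -pmulrn addrAC subrr add0r.
Qed.

Lemma jnorm (W : wmodel O) : j%:~R * mdisc W = mc4 W ^+ 3 ->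
  j ^+ 2 * qnorm (mdisc W) = qnorm (mc4 W) ^+ 3.
Proof. by move/(congr1 (@qnorm t c)); rewrite qnormM qnorm_int qnormX. Qed.

Lemma logn_norm_eq (l : nat) (a b m : int) (n k : nat) : prime l ->
  m != 0 -> b != 0 -> ~~ (l%:Z %| a)%Z -> m ^+ n * a = b ^+ k ->
  (n * logn l `|m| = k * logn l `|b|)%N.
Proof.
move=> pl m0 b0 na /(congr1 (fun z => logn l `|z|)).
have a0 : a != 0 by apply: contraNneq na => ->.
rewrite abszM lognM ?absz_gt0 ?expf_neq0 // !abszX !lognX (logn_notdvd pl na) addn0 //.
Qed.

(** Where [l] is unramified, j times a [P]-unit is the cube of c4. Where it is ramified, taking
    norms gives [3] dividing twice the valuation. *)
Lemma logn_j l : prime l -> j != 0 -> (3 %| logn l `|j|)%N.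
Proof.
move=> pl j0; have [[_ pP]|[P pP un]] := prime_cases pl.
- have [W [x [s [[x0 s0 nP] [e4 _ eD]]]]] := good pl pP.
  have [/jnorm eW _] := transferj x0 s0 e4 eD.
  have := logn_norm_eq pl j0 _ nP eW.
  have D1 : qnorm (mdisc W) != 0 by apply: contraNneq nP => h; rewrite /qnormal h dvdz0.
  have N0 : qnorm (mc4 W) != 0.
    by apply/eqP => h; move: eW; rewrite h => /eqP; rewrite mulf_eq0 expf_eq0 /= (negPf j0) (negPf D1).
  move=> /(_ N0) h; have : (3 %| 2 * logn l `|j|)%N by rewrite h dvdn_mulr.
  by rewrite Gauss_dvdr.
- have [W [x [s [[x0 s0 nP] [e4 _ eD]]]]] := good pl pP.
  have [eW _] := transferj x0 s0 e4 eD.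
  have D1 : mdisc W != 0 by apply: contraNneq nP => ->; exact: po0 pP.
  apply: (dvdn_logn_power pl pP un (s := 1) (z := mc4 W) (x := mdisc W) (y := 1)) => //.
  + apply/eqP => h; move: eW; rewrite h expr0n /= => /eqP; apply/negP.
    by rewrite qmulf_neq0 // quad_intE; apply: contraNneq j0 => -[->].
  + exact: po1 pP.
  + by rewrite expr1n !mulr1.
Qed.

(** At an unramified prime, j - 1728 times a [P]-unit is the square of c6. At a ramified prime the
    norm squares j - 1728 and says nothing of parity, hence the exclusion of 2 and [p]. *)
Lemma logn_j1728 l : prime l -> l != 2%N -> l != p -> j - 1728 != 0 ->
  (2 %| logn l `|(j - 1728)%R|)%N.
Proof.
move=> pl l2 lp j0; have [[[e|e] _]|[P pP un]] := prime_cases pl.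
- by rewrite e in l2.
- by rewrite e eqxx in lp.
- have [W [x [s [[x0 s0 nP] [e4 _ eD]]]]] := good pl pP.
  have [_ eW] := transferj x0 s0 e4 eD.
  have D1 : mdisc W != 0 by apply: contraNneq nP => ->; exact: po0 pP.
  apply: (dvdn_logn_power pl pP un (s := 1) (z := mc6 W) (x := mdisc W) (y := 1)) => //.
  + apply/eqP => h; move: eW; rewrite h expr0n /= => /eqP; apply/negP.
    by rewrite qmulf_neq0 // quad_intE; apply: contraNneq j0 => -[->].
  + exact: po1 pP.
  + by rewrite expr1n !mulr1.
Qed.

(** The discriminant of [A] is a twelfth power up to a unit at every prime, so 12 divides the
    exponent. *)
Lemma logn_norm_disc l : prime l -> (4 %| logn l `|qnorm (mdisc A)|)%N.
Proof.
move=> pl; have N0 := qnorm_neq0 D0; apply: (@dvdn_trans 12) => //.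
have [[_ pP]|[P pP un]] := prime_cases pl.
- have [W [x [s [[x0 s0 nP] [_ _ eD]]]]] := good pl pP.
  have D1 : qnorm (mdisc W) != 0 by apply: contraNneq nP => h; rewrite /qnormal h dvdz0.
  have := congr1 (fun z => logn l `|z|) (qnorm_scaled eD).
  rewrite !lognXM ?(qnorm_neq0 x0) ?expf_neq0 // (logn_notdvd pl nP) addn0 => e.
  by rewrite -(dvdn_addr _ (dvdn_mulr (logn l `|(s ^+ 2)%R|) (dvdnn 12))) e dvdn_mulr.
- have [W [x [s [[x0 s0 nP] [_ _ eD]]]]] := good pl pP.
  (* The norm is the discriminant times its conjugate; the latter is controlled at [P] by the
     conjugate of a model good at the conjugate prime. *)
  have [W' [x' [s' [[x0' s0' nP'] [_ _ eD']]]]] := good pl (po_conj pP).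
  have {}eD' := qconj_scaled eD'.
  have x1 : qconj x' != 0 by apply: contraNneq x0' => h; rewrite -(qconjK x') h; apply/eqP; congr pair => /=; ring.
  apply: (dvdn_logn_power pl pP un (s := s * s') (z := x * qconj x') (x := 1)
    (y := mdisc W * qconj (mdisc W'))) => //.
  + by rewrite mulf_neq0.
  + exact: qmulf_neq0.
  + exact: po1 pP.
  + exact: (poNM pP nP nP').
  + by rewrite mulr1 intrM -mulqconj quad_intX intrM; exact: mul_scaled.
Qed.

Lemma norm_disc_fourth_power : exists2 n : int, n != 0 & `|qnorm (mdisc A)| = n ^+ 4.
Proof. by apply: abs_power; [exact: qnorm_neq0 D0| |exact: logn_norm_disc]. Qed.

Lemma j_cube : exists a : int, j = a ^+ 3.
Proof.
have [->|j0] := eqVneq j 0; first by exists 0.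
have [r _ e] := abs_power (n := 3) j0 isT (fun l pl => logn_j pl j0).
have [h|h] := lerP 0 j; [exists r|exists (- r)].
  by rewrite -e ger0_norm.
by rewrite (_ : (- r) ^+ 3 = - r ^+ 3); [rewrite -e ltr0_norm // opprK|ring].
Qed.

Section AtTwo.
Variables (W : wmodel O) (x : O) (s : int).
Hypotheses (x0 : x != 0) (s0 : s != 0).
Hypothesis e4 : s%:~R ^+ 4 * mc4 A = x ^+ 4 * mc4 W.
Hypothesis e6 : s%:~R ^+ 6 * mc6 A = x ^+ 6 * mc6 W.
Hypothesis eD : s%:~R ^+ 12 * mdisc A = x ^+ 12 * mdisc W.
Hypothesis nD : ~~ (2 %| qnorm (mdisc W))%Z.

Lemma c4_norm_square (a : int) : qnorm (mc4 W) = 16 * a -> exists w : int, `|a| ^+ 3 = w ^+ 2.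
Proof.
move=> h; have [n n0 en] := norm_disc_fourth_power.
have := qnorm_scaled e4; rewrite h => E4.
have EJ := jnorm jE.
(* Taking norms in c4 ^ 3 = j D gives the cube of the norm of c4 of [A], up to sign, as the square
   of [j * n ^+ 2]; the 64 comes from [16 ^ 3 = 64 ^ 2]. *)
apply: (@square_quotient _ (j * n ^+ 2 * s ^+ 12) (qnorm x ^+ 6 * 64)).
  by rewrite mulf_neq0 // expf_neq0 // qnorm_neq0.
have A1 : j ^+ 2 * n ^+ 4 = `|qnorm (mc4 A)| ^+ 3.
  by rewrite -en -[j ^+ 2]ger0_norm ?sqr_ge0 // -normrM EJ normrX.
have A2 : (s ^+ 2) ^+ 4 * `|qnorm (mc4 A)| = qnorm x ^+ 4 * (16 * `|a|).
  have ge4 (z : int) : 0 <= z ^+ 4 by exact: exprn_even_ge0.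
  rewrite -(ger0_norm (ge4 (s ^+ 2))) -(ger0_norm (ge4 (qnorm x))).
  by rewrite -[X in _ = _ * (X * _)](normr_nat int 16) -!normrM E4.
transitivity ((qnorm x ^+ 4 * (16 * `|a|)) ^+ 3); first by ring.
by rewrite -A2 exprMn -A1; ring.
Qed.

(* [e] is 0 if the reduction at 2 is ordinary and 1 if it is supersingular. *)
Lemma no_model (e : bool) (a : int) : qnorm (mc6 W) = 64 ^+ e * a -> a != 0 ->
  (forall w : int, p%:Z * `|a| <> w ^+ 2) ->
  (if e then 16 ^+ 3 %| j else ~~ (2 %| j))%Z -> False.
Proof.
move=> h a0 npa hj; have [n n0 en] := norm_disc_fourth_power.
have [_ EW] := transferj x0 s0 e4 eD.
have [_ EA] := transferj (oner_neq0 O) (oner_neq0 int) (W := A) (erefl _) (erefl _).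
have N0 : qnorm (mc6 W) != 0 by rewrite h mulf_neq0 // expf_neq0.
set k := j - 1728 in EW EA *.
have k0 : k != 0.
  apply/eqP => k0; move: EW; rewrite k0 mul0r => /(congr1 (@qnorm t c)).
  by rewrite qnormX qnorm0 => /esym/eqP; rewrite expf_eq0 /= (negPf N0).
have := qnorm_scaled e6; rewrite h => E6.
have := congr1 (@qnorm t c) EA; rewrite qnormM qnormX qnorm_int => E2.
have Q : `|qnorm (mc6 A)| = `|k| * n ^+ 2.
  apply/eqP; rewrite -(eqrXn2 (n := 2)) ?(mulr_ge0 (normr_ge0 _) (sqr_ge0 n)) //.
  by rewrite -normrX -E2 normrM en normrX; apply/eqP; ring.
(* Hence [k] and [a] agree in absolute value up to a rational square, [64 ^+ e] being the square of
   [8 ^+ e]. *)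
have K : `|k| * (n * s ^+ 6) ^+ 2 = (qnorm x ^+ 3 * 8 ^+ e) ^+ 2 * `|a|.
  have ge6 (z : int) : 0 <= z ^+ 6 by exact: exprn_even_ge0.
  have A6 : (s ^+ 2) ^+ 6 * `|qnorm (mc6 A)| = qnorm x ^+ 6 * (64 ^+ e * `|a|).
    have e64 : 0 <= 64 ^+ e :> int by case: (e).
    rewrite -(ger0_norm (ge6 (s ^+ 2))) -(ger0_norm (ge6 (qnorm x))) -(ger0_norm e64).
    by rewrite -!normrM E6.
  transitivity ((s ^+ 2) ^+ 6 * (`|k| * n ^+ 2)); first by ring.
  by rewrite -Q A6; case: (e); ring.
have Z0 : n * s ^+ 6 != 0 by rewrite mulf_neq0 // expf_neq0.
have Y0 : qnorm x ^+ 3 * 8 ^+ e != 0 by rewrite mulf_neq0 ?expf_neq0 ?qnorm_neq0.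
(* In the ordinary case [k] is odd; in the supersingular case its valuation at 2 is 6, as 1728 is 64
   times 27. *)
have ev2 : (2 %| logn 2 `|k|)%N.
  case: (e) hj => hj; last first.
    rewrite logn_notdvd //; apply: contra hj => hk.
    by rewrite -[j](subrK 1728) dvdz_add.
  case/dvdzP: hj => b hb.
  rewrite /k hb (_ : b * 16 ^+ 3 - 1728 = 2 ^+ 6 * (64 * b - 27)); last by ring.
  have h2 := odd64 b.
  have m0 : 64 * b - 27 != 0 by apply: contraNneq h2 => ->.
  by rewrite lognXM // (logn_notdvd _ h2) // addn0 dvdn_mulr.
(* Now only [p] can have an odd exponent in [k]. If it is even, j being a cube gives the cubic
   equation; if it is odd, [p] times the absolute value of [a] is a square, which is excluded. *)
have [|l pl lp|y [hy|hy]] := @square_up_to_prime p `|k| pp; rewrite ?absz_gt0 //.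
- by have [->|l2] := eqVneq l 2%N; [|exact: logn_j1728].
- have [b hb] := j_cube.
  have sk : b ^+ 3 - 1728 = y%:Z ^+ 2 \/ b ^+ 3 - 1728 = - y%:Z ^+ 2.
    rewrite -hb -/k.
    have hy' : `|k| = y%:Z ^+ 2 by rewrite -abszE hy PoszX.
    rewrite -hy'; have [k1|k1] := leP 0 k; first by left; rewrite ger0_norm.
    by right; rewrite ltr0_norm ?opprK.
  case: (e) hj => hj.
    by apply: (cubic_div16 _ sk); rewrite -(@dvdz_pexp2r _ _ 3) // -hb.
  apply: (cubic_odd _ sk).
  have nb : ~~ (2 %| b)%Z by apply: contra hj => h2; rewrite hb exprS dvdz_mulr.
  exact: odd_int.
- have [w hw] : exists w : int, p%:Z * `|a| = w ^+ 2.
    apply: (@square_quotient _ (y%:Z * (n * s ^+ 6)) _ Y0).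
    rewrite [in RHS]exprMn (_ : y%:Z ^+ 2 = p%:Z * `|k|).
      by rewrite -[RHS]mulrA K -mulrA [`|a| * _]mulrC.
    by rewrite -abszE -PoszM hy PoszX.
  exact: npa hw.
Qed.
End AtTwo.
End GlobalArgument.

(** * Good reduction at 2 *)

Lemma odd_square_mod8 (z : int) : ~~ (2 %| z)%Z -> exists k, z ^+ 2 = 8 * k + 1.
Proof.
case/odd_int => m hm; have [k [h|h|h]] := square_mod8 z; exists k => //.
  by rewrite hm in h; lia.
by rewrite hm in h; lia.
Qed.

Lemma even_exp (x : int) (n : nat) : (2 %| x ^+ n)%Z -> (2 %| x)%Z.
Proof. by rewrite !dvdzE abszX Euclid_dvdX // => /andP[]. Qed.

Lemma coprimez_exp16 (x : int) (m n : nat) :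
  ~~ (2 %| x)%Z -> coprimez ((16 ^+ m) ^+ n) x.
Proof.
move=> hx; rewrite coprimezE !abszX; do 2!apply: coprimeXl.
by rewrite (_ : `|16|%N = 2 ^ 4)%N // coprimeXl // prime_coprime.
Qed.

Section Invariants2.
Variable R : comNzRingType.
Implicit Type W : wmodel R.

Lemma mc6_ordinary W : exists y, mc6 W = - m1 W ^+ 6 + 4 * y.
Proof.
exists (9 * mb2 W * mb4 W - 54 * mb6 W
  - (3 * m1 W ^+ 4 * m2 W + 12 * m1 W ^+ 2 * m2 W ^+ 2 + 16 * m2 W ^+ 3)).
by rewrite /mc6 /mb2; ring.
Qed.

Lemma mc4_ordinary W : exists y, mc4 W = m1 W ^+ 4 + 4 * y.
Proof.
exists (2 * m1 W ^+ 2 * m2 W + 4 * m2 W ^+ 2 - 6 * mb4 W).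
by rewrite /mc4 /mb2; ring.
Qed.

(** Here b2 is [4 * (a ^+ 2 + m2 W)] and b4 is [2 * (m4 W + a * m3 W)]. *)
Lemma mc6_supersingular W a : m1 W = 2 * a ->
  exists y, mc6 W = 8 * (- 27 * m3 W ^+ 2 + 4 * y).
Proof.
move=> H.
exists (9 * (a ^+ 2 + m2 W) * (m4 W + a * m3 W) - 2 * (a ^+ 2 + m2 W) ^+ 3 - 27 * m6 W).
by rewrite /mc6 /mb2 /mb4 /mb6 H; ring.
Qed.

Lemma mc4_supersingular W a : m1 W = 2 * a -> exists y, mc4 W = 16 * y.
Proof.
move=> H.
exists ((a ^+ 2 + m2 W) ^+ 2 - 3 * (m4 W + a * m3 W)).
by rewrite /mc4 /mb2 /mb4 H; ring.
Qed.

(** Exhibits the discriminant in the ideal generated by a1, a3 and 2. *)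
Lemma mdisc_decomposition W : mdisc W =
  m1 W * (m1 W * (9 * mb4 W * mb6 W - mb2 W * mb8 W)) - m3 W * (m3 W * (27 * mb6 W))
  + 2 * (2 * m2 W * (9 * mb4 W * mb6 W - mb2 W * mb8 W) - 4 * mb4 W ^+ 3 - 54 * m6 W * mb6 W).
Proof. by rewrite /mdisc /mb2 /mb6; ring. Qed.
End Invariants2.

Section LocalTwo.
Variables t c : int.
Local Notation O := (quad t c).

Lemma qnormN (x : O) : qnorm (- x) = qnorm x.
Proof. by rewrite /qnorm /=; ring. Qed.

Lemma qnorm_intM (n : int) (x : O) : qnorm (n%:~R * x) = n ^+ 2 * qnorm x.
Proof. by rewrite qnormM qnorm_int. Qed.

(* The modulus for which [4 y] does not change the norm: 4, or 8 when 2 is ramified. *)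
Variable M : int.
Hypothesis M8 : (M %| 8)%Z.
Hypothesis M2 : (2 %| M)%Z.
Hypothesis qnormDM : forall x y : O, exists k : int, qnorm (x + 4 * y) = qnorm x + M * k.

Variable W : wmodel O.
Hypothesis nD : ~~ (2 %| qnorm (mdisc W))%Z.
Variable j : int.
Hypothesis jE : j%:~R * mdisc W = mc4 W ^+ 3.

(** Modulo 4, c6 is [- m1 W ^+ 6] and c4 is [m1 W ^+ 4]; the sixth power of an odd norm is an odd
    square, hence 1 mod 8. *)
Lemma ordinary_at2 : ~~ (2 %| qnorm (m1 W))%Z ->
  (exists k, qnorm (mc6 W) = M * k + 1) /\ ~~ (2 %| j)%Z.
Proof.
move=> n1; have n3 : ~~ (2 %| qnorm (m1 W) ^+ 3)%Z by apply: contra n1; exact: even_exp.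
split.
  have [y ->] := mc6_ordinary W; have [k ->] := qnormDM (- m1 W ^+ 6) y.
  have [m hm] := odd_square_mod8 n3; have [M' hM] := dvdzP M8.
  exists (k + M' * m).
  by rewrite qnormN qnormX (exprM _ 3 2) hm mulrDr mulrA [M * M']mulrC -hM; ring.
apply: contra n1 => hj.
have : (2 %| qnorm (mc4 W) ^+ 3)%Z.
  by rewrite -(jnorm jE) dvdz_mulr // exprS dvdz_mulr.
move/even_exp.
have [y ->] := mc4_ordinary W; have [k ->] := qnormDM (m1 W ^+ 4) y.
have h2 : (2 %| M * k)%Z by exact: dvdz_mulr.
rewrite qnormX => h; apply: (@even_exp _ 4).
by rewrite -[_ ^+ 4](addrK (M * k)); exact: dvdz_sub.
Qed.

Lemma supersingular_at2 a : m1 W = 2 * a -> ~~ (2 %| qnorm (m3 W))%Z ->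
  (exists k, qnorm (mc6 W) = 64 * (M * k + 1)) /\ (16 ^+ 3 %| j)%Z.
Proof.
move=> ea n3; split.
  have [y ->] := mc6_supersingular ea.
  have [k hk] := qnormDM ((- 27)%:~R * m3 W ^+ 2) y.
  have [m hm] := odd_square_mod8 n3; have [M' hM] := dvdzP M8.
  (* The norm of -27 is 729, which is 8 times 91 plus 1. *)
  exists (k + M' * (729 * m + 91)).
  rewrite (pmulrn 1 8) (pmulrn 1 27) -mulrNz qnorm_intM hk.
  rewrite qnorm_intM qnormX hm.
  by rewrite (_ : M * (k + _) = M * k + M' * M * (729 * m + 91)); [rewrite -hM; ring|ring].
have := jnorm jE; have [y ->] := mc4_supersingular ea.
rewrite (pmulrn 1 16) qnorm_intM => e.
have : ((16 ^+ 3) ^+ 2 %| j ^+ 2 * qnorm (mdisc W))%Z.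
  by rewrite exprAC e; apply: dvdz_exp2r; exact: dvdz_mulr.
rewrite Gauss_dvdzl; last exact: coprimez_exp16.
by rewrite dvdz_pexp2r.
Qed.

Lemma a3_unit_at2 : prime_over 2 (fun x : O => (2 %| qnorm x)%Z) ->
  (2 %| qnorm (m1 W))%Z -> ~~ (2 %| qnorm (m3 W))%Z.
Proof.
move=> pP h1; apply: contra nD => h3; rewrite mdisc_decomposition.
have PM (x y : O) : (2 %| qnorm x)%Z -> (2 %| qnorm (x * y))%Z by rewrite qnormM; exact: dvdz_mulr.
have PN (x : O) : (2 %| qnorm x)%Z -> (2 %| qnorm (- x))%Z by rewrite qnormN.
apply: (poD pP); first apply: (poD pP); first exact: PM.
  by apply: PN; exact: PM.
by apply: PM; rewrite (pmulrn 1 2) qnorm_int.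
Qed.
End LocalTwo.

Lemma double_mulq (t c : int) (x : quad t c) : 2 * x = (2 * x.1, 2 * x.2).
Proof. by rewrite (pmulrn 1 2) intr_mulq. Qed.

(* [a1] has valuation 1 at the ramified prime above 2. *)
Lemma intermediate_at2 (p : nat) (W : wmodel (quad 0 (- p%:Z))) (a b : int) :
  (p %% 8 = 3)%N -> m1 W = (2 * a + 1, 2 * b + 1) -> ~~ (2 %| qnorm (m3 W))%Z ->
  exists k, qnorm (mc4 W) = 16 * (8 * k + 5).
Proof.
move=> hp e1 n3.
have [q hq] : exists q : int, p%:Z = 8 * q + 3 by exists (p %/ 8)%N; lia.
pose w : quad 0 (- p%:Z) := (0, 1).
have ww : w * w = p%:Z%:~R by rewrite quad_intE; congr pair => /=; ring.
(* Modulo 2, a1 is [1 + w], and its square is [1 + p + 2 w] with [1 + p] divisible by 4. *)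
have [k1 h1] : exists k, m1 W * m1 W = 2 * (w + 2 * k).
  exists (a ^+ 2 + a + p%:Z * (b ^+ 2 + b) + 2 * q + 1, 2 * a * b + a + b).
  by rewrite e1 !double_mulq; congr pair => /=; rewrite ?hq; ring.
(* An odd norm of [m3 W] means that [u + v] is odd, and [(1 + w) (u + v w)] is [(u + v) (1 + w)]
   modulo 2. *)
have [k2 h2] : exists k, m1 W * m3 W = 1 + w + 2 * k.
  move: n3; rewrite e1; case: (m3 W) => u v n3.
  have [n [h|h]] : exists n, u = 2 * n - v \/ u = 2 * n + 1 - v.
  - by exists ((u + v) %/ 2)%Z; lia.
  - case/negP: n3; apply/dvdzP; exists (2 * n ^+ 2 - 2 * n * v - (4 * q + 1) * v ^+ 2).
    by rewrite /qnorm /= h hq; ring.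
  exists (n + a * u + 8 * q * b * v + 4 * q * v + 3 * b * v + v, n + a * v + b * u).
  by rewrite !double_mulq; congr pair => /=; rewrite ?hq h; ring.
(* [z] is c4 divided by 4, modulo 4; its norm [p ^ 2 - 48 p + 36] is 5 mod 8. *)
pose z : quad 0 (- p%:Z) := (p%:Z - 6, -6).
pose y := w * (k1 + m2 W) + (k1 + m2 W) ^+ 2 - 3 * m4 W - 3 * k2.
have -> : mc4 W = 4%:~R * (z + 4 * y).
  have -> : z = w * w - 6 - 6 * w.
    by rewrite ww (pmulrn 1 6) !quad_intE; congr pair => /=; ring.
  by rewrite /mc4 /mb2 /mb4 h2 [m1 W ^+ 2]expr2 h1 /y; ring.
rewrite qnorm_intM; have [k ->] := qnormD8 z y (dvdz0 2).
exists (k + 8 * q ^+ 2 - 42 * q - 13).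
by rewrite /z /qnorm /= hq; ring.
Qed.

(** * Contradiction at 2 in the real and imaginary cases *)

Lemma no_good_models_real (p : nat) (A : wmodel (quad 0 (- p%:Z))) (j : int) :
  (forall x : quad 0 (- p%:Z), qnorm x = 0 -> x = 0) ->
  prime p -> (p %% 8 = 3)%N ->
  (forall l, prime l -> (l%:Z %| 0 ^+ 2 - 4 * (- p%:Z))%Z -> l = 2%N \/ l = p) ->
  (forall l, l = 2%N \/ l = p -> forall x y : quad 0 (- p%:Z),
    (l%:Z %| qnorm x)%Z -> (l%:Z %| qnorm y)%Z -> (l%:Z %| qnorm (x + y))%Z) ->
  good_models A -> mdisc A != 0 -> j%:~R * mdisc A = mc4 A ^+ 3 -> False.
Proof.
move=> aniso pp hp ram ideal good D0 jE.
have p2 : prime_over 2 (@qnormal 0 (- p%:Z) 2).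
  by apply: norm_prime_over => //; apply: ideal; left.
have [W [x [s [[x0 s0 nD] [e4 e6 eD]]]]] := good 2%N _ isT p2.
have [jW _] := transferj aniso jE x0 s0 e4 eD.
have D8 (y z : quad 0 (- p%:Z)) := qnormD8 y z (dvdz0 2).
have [q hq] : exists q : int, p%:Z = 8 * q + 3 by exists (p %/ 8)%N; lia.
(* [p] times the absolute value of [8 * k + 1] is 3 or 5 mod 8, according to the sign, and so is no
   square. *)
have fin (e : bool) (k : int) : qnorm (mc6 W) = 64 ^+ e * (8 * k + 1) ->
    (if e then 16 ^+ 3 %| j else ~~ (2 %| j))%Z -> False.
  move=> h6 hj; apply: (no_model aniso pp ram ideal good D0 jE x0 s0 e4 e6 eD h6 _ _ hj).
    by apply/eqP; lia.
  move=> w; have [m hm] := square_mod8 w.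
  have [k1|k1] := leP 0 (8 * k + 1); [rewrite ger0_norm // | rewrite ltr0_norm //];
  case: hm => ->; rewrite hq.
  - rewrite (_ : _ * _ = 8 * (8 * q * k + q + 3 * k) + 3); [lia|ring].
  - rewrite (_ : _ * _ = 8 * (8 * q * k + q + 3 * k) + 3); [lia|ring].
  - rewrite (_ : _ * _ = 8 * (8 * q * k + q + 3 * k) + 3); [lia|ring].
  - rewrite (_ : _ * - _ = 8 * - (8 * q * k + q + 3 * k) - 3); [lia|ring].
  - rewrite (_ : _ * - _ = 8 * - (8 * q * k + q + 3 * k) - 3); [lia|ring].
  - rewrite (_ : _ * - _ = 8 * - (8 * q * k + q + 3 * k) - 3); [lia|ring].
have [n1|n1] := boolP (2 %| qnorm (m1 W))%Z; last first.
  have [[k hk] hj] := ordinary_at2 (dvdzz 8) (isT : (2 %| 8)%Z) D8 jW n1.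
  by apply: (fin false k) => //; rewrite hk; ring.
have n3 := a3_unit_at2 nD p2 n1.
(* As [p] is odd, an even norm forces coordinates of equal parity: both even is the supersingular
   case, both odd the intermediate one. *)
have [a [b]] : exists a b, m1 W = (2 * a, 2 * b) \/ m1 W = (2 * a + 1, 2 * b + 1).
  move: n1; case: (m1 W) => u v /dvdzP[m]; rewrite /qnorm /= => hm.
  exists (u %/ 2)%Z, (v %/ 2)%Z.
  have [u' [hu|hu]] : exists u', u = 2 * u' \/ u = 2 * u' + 1 by exists (u %/ 2)%Z; lia.
  - have [v' [hv|hv]] : exists v', v = 2 * v' \/ v = 2 * v' + 1 by exists (v %/ 2)%Z; lia.
      by left; rewrite hu hv; congr pair; lia.
    by exfalso; move: hm; rewrite hu hv hq; lia.
  - have [v' [hv|hv]] : exists v', v = 2 * v' \/ v = 2 * v' + 1 by exists (v %/ 2)%Z; lia.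
      by exfalso; move: hm; rewrite hu hv hq; lia.
    by right; rewrite hu hv; congr pair; lia.
case=> e1; last first.
  have [k hk] := intermediate_at2 hp e1 n3.
  have [w] := c4_norm_square aniso ram ideal good D0 jE x0 e4 hk.
  have [m hm] := square_mod8 w.
  (* The cube of the absolute value of [z] is 5 or 3 mod 8, hence no square. *)
  set z := 8 * k + 5; have [l [hl|hl]] : exists l, `|z| = 8 * l + 5 \/ `|z| = 8 * l + 3.
    by have [z0|z0] := leP 0 z; [exists k; left|exists (- k - 1); right]; rewrite /z; lia.
  - rewrite hl (_ : (8 * l + 5) ^+ 3 = 8 * (64 * l ^+ 3 + 120 * l ^+ 2 + 75 * l + 15) + 5); last by ring.
    by case: hm => ->; lia.
  - rewrite hl (_ : (8 * l + 3) ^+ 3 = 8 * (64 * l ^+ 3 + 72 * l ^+ 2 + 27 * l + 3) + 3); last by ring.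
    by case: hm => ->; lia.
have e1' : m1 W = 2 * ((a, b) : quad 0 (- p%:Z)) by rewrite double_mulq.
have [[k hk] hj] := supersingular_at2 (dvdzz 8) D8 nD jW e1' n3.
by apply: (fin true k) => //; rewrite hk; ring.
Qed.

Lemma no_good_models_imag (p : nat) (c : int) (A : wmodel (quad 1 c)) (j : int) :
  (forall x : quad 1 c, qnorm x = 0 -> x = 0) ->
  prime p -> (p %% 8 = 3)%N -> 4 * c = p%:Z + 1 ->
  (forall l, prime l -> (l%:Z %| 1 ^+ 2 - 4 * c)%Z -> l = 2%N \/ l = p) ->
  (forall l, l = 2%N \/ l = p -> forall x y : quad 1 c,
    (l%:Z %| qnorm x)%Z -> (l%:Z %| qnorm y)%Z -> (l%:Z %| qnorm (x + y))%Z) ->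
  good_models A -> mdisc A != 0 -> j%:~R * mdisc A = mc4 A ^+ 3 -> False.
Proof.
move=> aniso pp hp hc ram ideal good D0 jE.
have p2 : prime_over 2 (@qnormal 1 c 2).
  by apply: norm_prime_over => //; apply: ideal; left.
have [W [x [s [[x0 s0 nD] [e4 e6 eD]]]]] := good 2%N _ isT p2.
have [jW _] := transferj aniso jE x0 s0 e4 eD.
have [q hq] : exists q : int, p%:Z = 8 * q + 3 by exists (p %/ 8)%N; lia.
have hc' : c = 2 * q + 1 by lia.
have norm_ge0 (z : quad 1 c) : 0 <= qnorm z.
  have : 0 <= 4 * qnorm z; last by rewrite pmulr_rge0.
  rewrite (_ : 4 * qnorm z = (2 * z.1 + z.2) ^+ 2 + p%:Z * z.2 ^+ 2).
    by apply: addr_ge0; [exact: sqr_ge0|apply: mulr_ge0 => //; exact: sqr_ge0].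
  by rewrite (_ : p%:Z = 4 * c - 1) /qnorm; [ring|lia].
(* Norms are nonnegative here, so no sign intervenes and [p * (4 * k + 1)], being 3 mod 4, is no
   square. *)
have fin (e : bool) (k : int) : qnorm (mc6 W) = 64 ^+ e * (4 * k + 1) ->
    (if e then 16 ^+ 3 %| j else ~~ (2 %| j))%Z -> False.
  move=> h6 hj; apply: (no_model aniso pp ram ideal good D0 jE x0 s0 e4 e6 eD h6 _ _ hj).
    by apply/eqP; lia.
  have k1 : 0 <= 4 * k + 1.
    by have := norm_ge0 (mc6 W); rewrite h6 pmulr_rge0 //; case: (e).
  move=> w; have [m hm] := square_mod8 w.
  rewrite ger0_norm // hq (_ : _ * _ = 4 * (8 * q * k + 2 * q + 3 * k) + 3); last by ring.
  by case: hm => ->; lia.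
have [n1|n1] := boolP (2 %| qnorm (m1 W))%Z; last first.
  have [[k hk] hj] := ordinary_at2 (isT : (4 %| 8)%Z) (isT : (2 %| 4)%Z) (@qnormD4 1 c) jW n1.
  by apply: (fin false k) => //; rewrite hk; ring.
have n3 := a3_unit_at2 nD p2 n1.
(* As [c] is odd, 2 is inert: an even norm forces both coordinates to be even, so there is no
   intermediate case. *)
have [a [b e1]] : exists a b, m1 W = (2 * a, 2 * b).
  move: n1; case: (m1 W) => u v /dvdzP[m]; rewrite /qnorm /= => hm.
  exists (u %/ 2)%Z, (v %/ 2)%Z.
  have [u' [hu|hu]] : exists u', u = 2 * u' \/ u = 2 * u' + 1 by exists (u %/ 2)%Z; lia.
  - have [v' [hv|hv]] : exists v', v = 2 * v' \/ v = 2 * v' + 1 by exists (v %/ 2)%Z; lia.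
      by rewrite hu hv; congr pair; lia.
    by exfalso; move: hm; rewrite hu hv hc'; lia.
  - have [v' [hv|hv]] : exists v', v = 2 * v' \/ v = 2 * v' + 1 by exists (v %/ 2)%Z; lia.
      by exfalso; move: hm; rewrite hu hv hc'; lia.
    by exfalso; move: hm; rewrite hu hv hc'; lia.
have e1' : m1 W = 2 * ((a, b) : quad 1 c) by rewrite double_mulq.
have [[k hk] hj] := supersingular_at2 (isT : (4 %| 8)%Z) (@qnormD4 1 c) nD jW e1' n3.
by apply: (fin true k) => //; rewrite hk; ring.
Qed.

(** * Rings of integers of quadratic fields *)

(** For nonzero [b] the exponent of [p] would be even on the left and odd on the right. *)
Lemma prime_mul_square_eq (p : nat) (a b : int) : prime p ->
  a ^+ 2 = p%:Z * b ^+ 2 -> b = 0.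
Proof.
move=> pp e; apply/eqP; apply: contraT => b0.
have p0 : p%:Z != 0 by rewrite eqz_nat -lt0n prime_gt0.
have a0 : a != 0.
  by apply/eqP => a0; move: e; rewrite a0 expr0n => /esym/eqP; rewrite mulf_eq0 expf_eq0 /= (negPf p0) (negPf b0).
have := congr1 (fun z => odd (logn p `|z|)) e.
rewrite /= abszX lognX abszM abszX lognM ?expn_gt0 ?absz_gt0 ?b0 ?p0 //.
by rewrite absz_nat lognX (logn_prime p pp) oddD !oddM eqxx.
Qed.

(** The square of the denominator of [r] divides [p], so the denominator is 1. *)
Lemma prime_mul_square_int (p : nat) (r : rat) : prime p ->
  p%:R * r ^+ 2 \is a Num.int -> r \is a Num.int.
Proof.
move=> pp /intrP[k hk]; rewrite Qint_def.
have d0 : (denq r)%:~R != 0 :> rat by rewrite intr_eq0 denq_neq0.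
have e : p%:Z * numq r ^+ 2 = k * denq r ^+ 2.
  have er : (numq r)%:~R = r * (denq r)%:~R by rewrite -{2}(divq_num_den r) divfK.
  apply: (@intr_inj rat); rewrite intrM [RHS]intrM -hk !rmorphXn /= er -pmulrn; ring.
have : (denq r ^+ 2 %| p%:Z)%Z.
  have : (denq r ^+ 2 %| p%:Z * numq r ^+ 2)%Z by rewrite e dvdz_mull.
  rewrite Gauss_dvdzl // coprimezE !abszX coprimeXl // coprimeXr // coprime_sym.
  exact: coprime_num_den.
rewrite dvdzE abszX /= => h.
have : (`|denq r| %| p)%N by apply: dvdn_trans h; rewrite expnS dvdn_mulr.
have [_ /[apply]] := primeP pp; case/pred2P => [d1|dp].
  by rewrite -(gtz0_abs (denq_gt0 r)) d1.
by move: h; rewrite dp => /dvdn_leq; have := prime_gt1 pp; nia.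
Qed.

Section IntegralClosure.
Variables (t c : int) (w : algC).
Local Notation O := (quad t c).
Hypothesis aniso : forall x : O, qnorm x = 0 -> x = 0.
Hypothesis wE : w ^+ 2 = t%:~R * w - c%:~R.

Lemma emb_rat (a b : rat) : exists (x : O) (s : int),
  s != 0 /\ (ratr a + ratr b * w) * s%:~R = emb w x.
Proof.
exists ((numq a * denq b, numq b * denq a) : O), (denq a * denq b).
split; first by rewrite mulf_neq0 ?denq_neq0.
have H (r : rat) : ratr r = (numq r)%:~R / (denq r)%:~R :> algC by [].
have d0 (r : rat) : (denq r)%:~R != 0 :> algC by rewrite intr_eq0 denq_neq0.
by rewrite !H /emb /= !intrM; field; rewrite !d0.
Qed.

Lemma gen_irrational (r : rat) : w != ratr r.
Proof.
apply/eqP => e; have d0 : (denq r)%:~R != 0 :> algC by rewrite intr_eq0 denq_neq0.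
have : emb w ((- numq r, denq r) : O) = 0.
  by rewrite /emb /= e intrN mulrC divfK // addNr.
move/(emb_eq0 aniso wE) => -[_ /eqP]; by rewrite (negPf (denq_neq0 r)).
Qed.

(** The two quantities are the trace and the norm. For nonzero [b] they are, up to sign,
    coefficients of the minimal polynomial, which is integral for an algebraic integer. *)
Lemma Aint_quadratic (a b : rat) : ratr a + ratr b * w \in Aint ->
  (2 * a + t%:~R * b \is a Num.int) &&
  (a ^+ 2 + t%:~R * (a * b) + c%:~R * b ^+ 2 \is a Num.int).
Proof.
move=> h; have [b0|b0] := eqVneq b 0.
  have : ratr a \is a @Num.int algC.
    by apply: Cint_rat_Aint; [exact: Crat_rat|rewrite b0 rmorph0 mul0r addr0 in h].
  by rewrite Cint_rat b0 !mulr0 !addr0 => ha; rewrite rpredX // rpredM.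
set T := 2 * a + t%:~R * b; set N := a ^+ 2 + t%:~R * (a * b) + c%:~R * b ^+ 2.
set z := ratr a + ratr b * w in h.
pose f : {poly rat} := 'X^2 - (T *: 'X - N%:P).
have sf : size f = 3%N.
  rewrite size_polyDl size_polyXn // size_polyN.
  rewrite (leq_ltn_trans (size_polyD _ _)) // gtn_max size_polyN.
  rewrite (leq_ltn_trans (size_scale_leq _ _)) ?size_polyX //.
  by rewrite (leq_ltn_trans (size_polyC_leq1 _)).
have mf : f \is monic.
  rewrite monicE lead_coefE sf /f !coefE /=.
  by rewrite !mulr0 subrr oppr0 addr0.
have [q [eq mq] hq] := minCpolyP z.
have qf : q %| f.
  rewrite -hq rootE /f !rmorphB /= map_polyXn map_polyZ map_polyX map_polyC.
  have eT : ratr T = 2 * ratr a + t%:~R * ratr b :> algC.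
    by rewrite /T rmorphD !rmorphM rmorph_int rmorph_nat.
  have eN : ratr N = ratr a ^+ 2 + t%:~R * (ratr a * ratr b) + c%:~R * ratr b ^+ 2 :> algC.
    by rewrite /N !rmorphD !rmorphM !rmorph_int.
  rewrite !hornerE /= eT eN /z.
  have w0 : w ^+ 2 - (t%:~R * w - c%:~R) = 0 by rewrite wE subrr.
  by rewrite -(mulr0 (ratr b ^+ 2)) -w0; apply/eqP; ring.
(* A minimal polynomial of degree 1 would make [w] rational. *)
have sq : (2 < size q)%N.
  have s1 : (1 < size q)%N by have := size_minCpoly z; rewrite eq size_map_poly.
  rewrite ltn_neqAle s1 andbT eq_sym; apply/eqP => s2.
  have := root_minCpoly z; rewrite eq rootE horner_coef size_map_poly s2.
  rewrite !big_ord_recl big_ord0 /= !coef_map /= expr0 expr1 addr0 mulr1.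
  have -> : q`_1 = 1 by have := monicP mq; rewrite lead_coefE s2.
  rewrite rmorph1 mul1r => /eqP e.
  have := gen_irrational (- (q`_0 + a) / b).
  have b0' : ratr b != 0 :> algC by rewrite fmorph_eq0.
  rewrite rmorphM fmorphV rmorphN rmorphD /= => /eqP; case.
  apply: (mulfI b0'); rewrite mulrCA divff // mulr1.
  by apply/eqP; rewrite -subr_eq0 opprK -e /z; apply/eqP; ring.
have qe : q = f.
  apply/eqP; rewrite -eqp_monic // -dvdp_size_eqp // sf eqn_leq sq andbT -sf.
  by apply: dvdp_leq => //; rewrite -size_poly_eq0 sf.
have {}h : minCpoly z \is a polyOver Num.int := h.
move: h; rewrite eq qe => /polyOverP h.
have := h 1%N; have := h 0%N; rewrite !coef_map /= !Cint_rat /f !coefE /=.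
by rewrite mulr0 mulr1 !(sub0r, subr0, opprK, rpredN) => -> ->.
Qed.
End IntegralClosure.

Lemma even_or_odd (m : int) : exists k, m = 2 * k \/ m = 2 * k + 1.
Proof. by exists (m %/ 2)%Z; lia. Qed.

Lemma emb_Aint (t c : int) (w : algC) (x : quad t c) :
  w ^+ 2 = t%:~R * w - c%:~R -> emb w x \in Aint.
Proof.
move=> wE; suff wA : w \in Aint by rewrite rpredD ?rpredM ?Aint_int.
pose f : {poly algC} := 'X^2 - (t%:~R *: 'X - (c%:~R)%:P).
apply: (@root_monic_Aint f).
- by rewrite rootE /f !hornerE wE subrr.
- have sf : size f = 3%N.
    rewrite size_polyDl size_polyXn // size_polyN.
    rewrite (leq_ltn_trans (size_polyD _ _)) // gtn_max size_polyN.
    rewrite (leq_ltn_trans (size_scale_leq _ _)) ?size_polyX //.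
    by rewrite (leq_ltn_trans (size_polyC_leq1 _)).
  rewrite monicE lead_coefE sf /f !coefE /=.
  by rewrite !mulr0 subrr oppr0 addr0.
- apply/polyOverP => i; rewrite /f !coefE.
  by apply: rpredB; [|apply: rpredB; [apply: rpredM|case: (i == 0)%N]];
    rewrite ?intr_int ?natr_int ?rpred0.
Qed.

(** Modulo [l] the norm is, up to the unit [k], the square of a linear form, so it vanishes on the
    kernel of that form. *)
Lemma norm_ideal_linear (t c : int) (l : nat) (k a b : int) : prime l -> ~~ (l%:Z %| k)%Z ->
  (forall x : quad t c, (l%:Z %| k * qnorm x - (a * x.1 + b * x.2) ^+ 2)%Z) ->
  forall x y : quad t c, (l%:Z %| qnorm x)%Z -> (l%:Z %| qnorm y)%Z ->
    (l%:Z %| qnorm (x + y))%Z.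
Proof.
move=> pl nk H x y hx hy.
have H1 (z : quad t c) : (l%:Z %| qnorm z)%Z -> (l%:Z %| a * z.1 + b * z.2)%Z.
  move=> hz; have : (l%:Z %| (a * z.1 + b * z.2) ^+ 2)%Z.
    have -> : (a * z.1 + b * z.2) ^+ 2 = k * qnorm z - (k * qnorm z - (a * z.1 + b * z.2) ^+ 2).
      by rewrite subKr.
    by apply: dvdz_sub; [exact: dvdz_mull|exact: H].
  by rewrite dvdzE abszX Euclid_dvdX // => /andP[].
have h : (l%:Z %| k * qnorm (x + y))%Z.
  rewrite -[k * _](subrK ((a * (x + y).1 + b * (x + y).2) ^+ 2)).
  apply: dvdz_add; first exact: H.
  rewrite exprS; apply: dvdz_mulr.
  have -> : a * (x + y).1 + b * (x + y).2 = (a * x.1 + b * x.2) + (a * y.1 + b * y.2).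
    by rewrite /=; ring.
  by apply: dvdz_add; exact: H1.
have : (l %| `|k| * `|qnorm (x + y)%R|)%N by rewrite -abszM; exact: h.
by rewrite Euclid_dvdM // => /orP[h'|//]; case/negP: nk.
Qed.

(** * From the orders back to curves over the two fields *)

Lemma no_curve (t c d : int) (w : algC) (p : nat) :
  (forall x : quad t c, qnorm x = 0 -> x = 0) ->
  w ^+ 2 = t%:~R * w - c%:~R ->
  (forall z, inOK d z <-> exists x : quad t c, z = emb w x) ->
  (forall z, inQuadField d z -> exists (x : quad t c) (s : int), s != 0 /\ z * s%:~R = emb w x) ->
  (forall l, prime l -> (l%:Z %| t ^+ 2 - 4 * c)%Z -> l = 2%N \/ l = p) ->
  (forall l, l = 2%N \/ l = p -> forall x y : quad t c,
    (l%:Z %| qnorm x)%Z -> (l%:Z %| qnorm y)%Z -> (l%:Z %| qnorm (x + y))%Z) ->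
  (forall (A : wmodel (quad t c)) (j : int), good_models A -> mdisc A != 0 ->
    j%:~R * mdisc A = mc4 A ^+ 3 -> False) ->
  ~ exists E : weier,
      [/\ ell_curve_over d E, everywhere_good d E & is_rational (jinv E)].
Proof.
move=> aniso wE inOKE inKE ram ideal fin [E [hE gE [q hq]]].
have [A [good D0 eJ]] := integral_good_models aniso wE inOKE inKE hE gE.
(* The rational j becomes a relation with coprime integer coefficients, and integrality of j makes
   the denominator 1. *)
have e : (numq q)%:~R * mdisc A = (denq q)%:~R * mc4 A ^+ 3.
  apply: (emb_inj aniso wE); rewrite [LHS]embM // [RHS]embM // embX // !emb_int // -eJ hq.
  rewrite mulrA; congr (_ * _).
  have d0 : (denq q)%:~R != 0 :> algC by rewrite intr_eq0 denq_neq0.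
  by rewrite /ratr mulrC divfK.
have cop : coprimez (numq q) (denq q) by rewrite coprimezE coprime_num_den.
have := integral_jinv aniso ram ideal good (denq_neq0 q) cop e.
move=> d1; have dq : denq q = 1 by rewrite -(gtz0_abs (denq_gt0 q)) d1.
by apply: (fin A (numq q) good D0); rewrite e dq mul1r.
Qed.

Lemma no_curve_real (p : nat) : prime p -> (p %% 8 = 3)%N ->
  ~ exists E : weier,
      [/\ ell_curve_over (Posz p) E, everywhere_good (Posz p) E & is_rational (jinv E)].
Proof.
move=> pp hp.
have [q hq] : exists q : int, p%:Z = 8 * q + 3 by exists (p %/ 8)%N; lia.
pose w : algC := sqrtC ((Posz p)%:~R).
have wE : w ^+ 2 = (0 : int)%:~R * w - (- p%:Z)%:~R.
  by rewrite sqrtCK mul0r sub0r rmorphN opprK.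
have aniso (x : quad 0 (- p%:Z)) : qnorm x = 0 -> x = 0.
  case: x => u v; rewrite /qnorm /= => h.
  have e : u ^+ 2 = p%:Z * v ^+ 2 by apply/eqP; rewrite -subr_eq0 -h; apply/eqP; ring.
  have v0 := prime_mul_square_eq pp e.
  by move: e; rewrite v0 expr0n mulr0 => /eqP; rewrite expf_eq0 => /eqP->.
have ram l : prime l -> (l%:Z %| 0 ^+ 2 - 4 * (- p%:Z))%Z -> l = 2%N \/ l = p.
  move=> pl; rewrite (_ : 0 ^+ 2 - 4 * - p%:Z = (2 ^ 2 * p)%N%:Z); last by rewrite PoszM; ring.
  rewrite dvdzE !absz_nat Euclid_dvdM // Euclid_dvdX // !dvdn_prime2 //.
  by case/orP => [/andP[/eqP]|/eqP]; [left|right].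
have ideal l : l = 2%N \/ l = p -> forall x y : quad 0 (- p%:Z),
    (l%:Z %| qnorm x)%Z -> (l%:Z %| qnorm y)%Z -> (l%:Z %| qnorm (x + y))%Z.
  case=> ->.
    (* The norm [u ^ 2 - p v ^ 2] is [(u + v) ^ 2] modulo 2, and [u ^ 2] modulo [p]. *)
    apply: (@norm_ideal_linear _ _ _ 1 1 1) => // x; apply/dvdzP.
    by exists (- (x.1 * x.2) - (4 * q + 2) * x.2 ^+ 2); rewrite /qnorm hq; ring.
  apply: (@norm_ideal_linear _ _ _ 1 1 0) => // [|x].
    by rewrite dvdz1 /=; apply: contraL pp => /eqP->.
  by apply/dvdzP; exists (- x.2 ^+ 2); rewrite /qnorm; ring.
have inOKE z : inOK (Posz p) z <-> exists x : quad 0 (- p%:Z), z = emb w x.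
  split=> [[[a [b ->]] zA]|[x ->]]; last first.
    split; last exact: emb_Aint.
    by exists x.1%:~R, x.2%:~R; rewrite !ratr_int.
  have /andP[/intrP[m hm] /intrP[N hN]] := Aint_quadratic aniso wE zA.
  have {}hm : 2 * a = m%:~R by rewrite -hm mul0r addr0.
  have {}hN : a ^+ 2 - p%:R * b ^+ 2 = N%:~R by rewrite -hN rmorphN -pmulrn; ring.
  have /intrP[n hn] : 2 * b \is a Num.int.
    apply: (prime_mul_square_int pp); apply/intrP; exists (m ^+ 2 - 4 * N).
    by rewrite intrB rmorphXn intrM /= -hm -hN; ring.
  have e : m ^+ 2 - p%:Z * n ^+ 2 = 4 * N.
    apply: (@intr_inj rat); rewrite intrB !intrM /= -hm -hn -hN -pmulrn; ring.
  (* As [p] is 3 mod 4, [m ^+ 2 - p * n ^+ 2] is divisible by 4 only if both are even. *)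
  have [m' [n' [hm' hn']]] : exists m' n', m = 2 * m' /\ n = 2 * n'.
    have [u hu] := even_or_odd m; have [v hv] := even_or_odd n; exists u, v.
    by case: hu => hu; case: hv => hv; move: e; rewrite hu hv hq; lia.
  have n2 : (2 : rat) != 0 by [].
  exists (m', n'); rewrite /emb /=.
  have -> : a = m'%:~R by apply: (mulfI n2); rewrite hm hm' intrM.
  have -> : b = n'%:~R by apply: (mulfI n2); rewrite hn hn' intrM.
  by rewrite !ratr_int.
have inKE z : inQuadField (Posz p) z ->
    exists (x : quad 0 (- p%:Z)) (s : int), s != 0 /\ z * s%:~R = emb w x.
  by case=> a [b ->]; exact: emb_rat.
apply: (no_curve aniso wE inOKE inKE ram ideal) => A j.
exact: no_good_models_real.
Qed.

Lemma no_curve_imag (p : nat) : prime p -> (p %% 8 = 3)%N ->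
  ~ exists E : weier,
      [/\ ell_curve_over (- Posz p) E, everywhere_good (- Posz p) E & is_rational (jinv E)].
Proof.
move=> pp hp.
have [q hq] : exists q : int, p%:Z = 8 * q + 3 by exists (p %/ 8)%N; lia.
pose c : int := 2 * q + 1.
have hc : 4 * c = p%:Z + 1 by rewrite hq /c; ring.
have pc : p%:Z = 4 * c - 1 by rewrite hc addrK.
pose r : algC := sqrtC ((- Posz p)%:~R).
pose w : algC := (1 + r) / 2.
have n2 : (2 : algC) != 0 by rewrite pnatr_eq0.
have hr : r = 2 * w - 1 by rewrite /w; field.
have wE : w ^+ 2 = (1 : int)%:~R * w - c%:~R.
  have r2 : r ^+ 2 = 1 - 4 * c%:~R.
    by rewrite sqrtCK pc opprB intrB intrM.
  by rewrite /w expr_div_n sqrrD r2; field.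
have aniso (x : quad 1 c) : qnorm x = 0 -> x = 0.
  case: x => u v; rewrite /qnorm /= => h.
  have e : (2 * u + v) ^+ 2 + p%:Z * v ^+ 2 = 0.
    by rewrite -(mulr0 4) -h pc; ring.
  have v0 : v = 0.
    apply/eqP; rewrite -(sqrf_eq0 v) eq_le sqr_ge0 andbT.
    have p0 : 0 < p%:Z by rewrite ltz_nat prime_gt0.
    by rewrite -(pmulr_rle0 _ p0) -e lerDr sqr_ge0.
  by move: e; rewrite v0 addr0 expr0n mulr0 addr0 => /eqP; rewrite expf_eq0 mulf_eq0 /= => /eqP->.
have ram l : prime l -> (l%:Z %| 1 ^+ 2 - 4 * c)%Z -> l = 2%N \/ l = p.
  move=> pl; rewrite hc (_ : 1 ^+ 2 - _ = - p%:Z); last by ring.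
  by rewrite dvdzE abszN !absz_nat dvdn_prime2 // => /eqP; right.
have ideal l : l = 2%N \/ l = p -> forall x y : quad 1 c,
    (l%:Z %| qnorm x)%Z -> (l%:Z %| qnorm y)%Z -> (l%:Z %| qnorm (x + y))%Z.
  case=> ->.
    have H (x : quad 1 c) : (2 %| qnorm x)%Z -> exists2 y : int * int, x.1 = 2 * y.1 & x.2 = 2 * y.2.
      case: x => u v; rewrite /qnorm /= => /dvdzP[k hk].
      have [a ha] := even_or_odd u; have [b hb] := even_or_odd v; exists (a, b) => /=;
      by case: ha => ha; case: hb => hb; move: hk; rewrite ha hb /c; lia.
    move=> x y /H[[a b] /= ha hb] /H[[a' b'] /= ha' hb'].
    apply/dvdzP; exists (2 * qnorm ((a + a', b + b') : quad 1 c)).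
    by rewrite /qnorm /= ha hb ha' hb'; ring.
  (* Four times the norm of [u + v w] is [(2 u + v) ^ 2 + p v ^ 2]. *)
  apply: (@norm_ideal_linear _ _ _ 4 2 1) => // [|x].
    apply/negP => h; have : (p %| 2 ^ 2)%N by exact: h.
    rewrite Euclid_dvdX // dvdn_prime2 //; move/andP => [/eqP e _]; move: hq; rewrite e; lia.
  by apply/dvdzP; exists (x.2 ^+ 2); rewrite /qnorm pc; ring.
have inOKE z : inOK (- Posz p) z <-> exists x : quad 1 c, z = emb w x.
  split=> [[[a0 [b0 ->]] zA]|[x ->]]; last first.
    split; last exact: emb_Aint.
    exists (x.1%:~R + x.2%:~R / 2), (x.2%:~R / 2).
    by rewrite !(rmorphD, rmorphM, fmorphV, ratr_int, rmorph_nat) /= /emb /w -/r; field.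
  have [a [b ez]] : exists a b : rat, ratr a0 + ratr b0 * r = ratr a + ratr b * w.
    exists (a0 - b0), (2 * b0); rewrite rmorphB rmorphM rmorph_nat hr /=; ring.
  rewrite -/r ez in zA *.
  have /andP[/intrP[m hm] /intrP[N hN]] := Aint_quadratic aniso wE zA.
  rewrite !mul1r in hm hN.
  have hp' : p%:R = 4 * c%:~R - 1 :> rat.
    by rewrite pmulrn pc intrB intrM.
  have /intrP[n hn] : b \is a Num.int.
    (* Four times the norm minus the square of the trace is [p * b ^ 2]. *)
    apply: (prime_mul_square_int pp); apply/intrP; exists (4 * N - m ^+ 2).
    by rewrite intrB rmorphXn intrM /= -hm -hN hp'; ring.
  have e : m ^+ 2 + p%:Z * n ^+ 2 = 4 * N.
    apply: (@intr_inj rat); rewrite intrD !intrM /= -hm -hn -hN -pmulrn hp'; ring.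
  have [k hk] : exists k, m = 2 * k + n.
    have [u hu] := even_or_odd m; have [v hv] := even_or_odd n; exists (u - v).
    by case: hu => hu; case: hv => hv; move: e; rewrite hu hv hq; lia.
  have n2' : (2 : rat) != 0 by [].
  exists (k, n); rewrite /emb /=.
  suff -> : a = k%:~R by rewrite hn !ratr_int.
  by apply: (mulfI n2'); apply: (addIr b); rewrite hm hk intrD intrM hn.
have inKE z : inQuadField (- Posz p) z ->
    exists (x : quad 1 c) (s : int), s != 0 /\ z * s%:~R = emb w x.
  case=> a [b ->]; rewrite -/r hr.
  have [x [s [s0 e]]] := emb_rat 1 c w (a - b) (2 * b).
  by exists x, s; split => //; rewrite -e rmorphB rmorphM rmorph_nat /=; ring.
apply: (no_curve aniso wE inOKE inKE ram ideal) => A j.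
exact: (no_good_models_imag aniso pp hp hc).
Qed.

Theorem theorem1p7 (p : nat) (hp : prime p) (hmod : (p %% 8 = 3)%N) :
  (~ exists E : weier,
      [/\ ell_curve_over (Posz p) E, everywhere_good (Posz p) E
        & is_rational (jinv E)]) /\
  (~ exists E : weier,
      [/\ ell_curve_over (- Posz p) E, everywhere_good (- Posz p) E
        & is_rational (jinv E)]).
Proof. by split; [exact: no_curve_real|exact: no_curve_imag]. Qed.
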